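(* Let $(Z,\alpha)$ be a quasi-metric antipodal space. Then the Moebius space $\mathcal{M}(Z)$ is a maximal Gromov hyperbolic space.
   Context: Antipodal spaces and Moebius spaces. Let $Z$ be a compact metrizable space containing at least four points. A separating function on $Z$ is a continuous function $\rho : Z\times Z\to[0,\infty)$ which is symmetric and satisfies $\rho(\xi,\eta)=0$ if and only if $\xi=\eta$. Its cross-ratio is defined on quadruples of distinct points of $Z$ by $[\xi,\xi',\eta,\eta']_\rho=\frac{\rho(\xi,\eta)\rho(\xi',\eta')}{\rho(\xi,\eta')\rho(\xi',\eta)}$. Two separating functions are Moebius equivalent if their cross-ratios agree. If $\rho_1,\rho_2$ are Moebius equivalent, there is a unique positive continuous function $\frac{d\rho_2}{d\rho_1}:Z\to(0,\infty)$, the derivative, such that $\rho_2(\xi,\eta)^2=\frac{d\rho_2}{d\rho_1}(\xi)\frac{d\rho_2}{d\rho_1}(\eta)\rho_1(\xi,\eta)^2$ for all $\xi,\eta\in Z$. An antipodal function on $Z$ is a separating function $\rho$ such that $\sup_{\xi,\eta}\rho(\xi,\eta)=1$ and for every $\xi\in Z$ there is $\eta\in Z$ with $\rho(\xi,\eta)=1$. An antipodal space $(Z,\alpha)$ is such a space $Z$ equipped with an antipodal function $\alpha$. Its Moebius space $\mathcal{M}(Z)=\mathcal{M}(Z,\alpha)$ is the set of all antipodal functions on $Z$ Moebius equivalent to $\alpha$, with the metric $d_{\mathcal{M}}(\rho_1,\rho_2)=\left\|\log\frac{d\rho_2}{d\rho_1}\right\|_\infty$. The antipodal space is quasi-metric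 if for some $K\ge1$, $\alpha(\xi,\eta)\le K\max(\alpha(\xi,\zeta),\alpha(\zeta,\eta))$ for all $\xi,\eta,\zeta\in Z$. Boundary continuous Gromov hyperbolic spaces. $(y|z)_x=\frac12(d(x,y)+d(x,z)-d(y,z))$ is the Gromov product. For a proper geodesic Gromov hyperbolic space $X$, $\partial X$ is its visual (Gromov) boundary and $\overline X=X\cup\partial X$ its visual compactification. $X$ is boundary continuous if for each $x\in X$ the Gromov product $(\cdot|\cdot)_x$ extends to a continuous function $\overline X\times\overline X\to[0,+\infty]$; then $\rho_x(\xi,\eta)=e^{-(\xi|\eta)_x}$ for $\xi,\eta\in\partial X$, and the cross-ratio of $\rho_x$ on $\partial X$ does not depend on $x$. A map between boundaries is Moebius if it preserves these cross-ratios on quadruples of distinct points. A space is geodesically complete if every geodesic segment extends to a bi-infinite geodesic. Maximal Gromov hyperbolic spaces. A proper, geodesic, geodesically complete, boundary continuous Gromov hyperbolic space $X$ is a maximal Gromov hyperbolic space if for every proper, geodesic, geodesically complete, boundary continuous Gromov hyperbolic space $Y$ and every Moebius homeomorphism $g:\partial Y\to\partial X$, there is an isometric (distance-preserving) embedding $G:Y\to X$ extending $g$, meaning that the map $\overline Y\to\overline X$ equal to $G$ on $Y$ and $g$ on $\partial Y$ is continuous. *)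

(* Defs.v *)
From HB Require Import structures.
From mathcomp Require Import all_boot all_order all_algebra.
From mathcomp Require Import all_classical all_reals all_analysis.
From mathcomp Require Import ring lra.

Set Implicit Arguments.
Unset Strict Implicit.
Unset Printing Implicit Defensive.

Import Order.TTheory GRing.Theory Num.Theory.
Import numFieldNormedType.Exports.

Local Open Scope classical_set_scope.
Local Open Scope ring_scope.

Definition metrizable (R : realType) (Z : topologicalType) : Prop :=
  exists d : Z -> Z -> R,
    [/\ forall x y, d x y = 0 <-> x = y,
        forall x y, d x y = d y x,
        forall x y z, d x z <= d x y + d y z &
        forall x, nbhs x =
          filter_from [set e : R | 0 < e] (fun e => [set y | d x y < e])].

Definition separating (R : realType) (Z : topologicalType)
    (rho : Z -> Z -> R) : Prop :=
  [/\ continuous (fun p : Z * Z => rho p.1 p.2),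
      forall x y, 0 <= rho x y,
      forall x y, rho x y = rho y x &
      forall x y, rho x y = 0 <-> x = y].

Definition cross_ratio (R : realType) (T : Type) (rho : T -> T -> R)
    (x x' y y' : T) : R :=
  (rho x y * rho x' y') / (rho x y' * rho x' y).

Definition moebius_equivalent (R : realType) (T : eqType)
    (rho1 rho2 : T -> T -> R) : Prop :=
  forall x x' y y' : T, uniq [:: x; x'; y; y'] ->
    cross_ratio rho1 x x' y y' = cross_ratio rho2 x x' y y'.

Definition is_derivative (R : realType) (Z : topologicalType)
    (rho1 rho2 : Z -> Z -> R) (f : Z -> R) : Prop :=
  [/\ continuous f, forall x, 0 < f x &
      forall x y, rho2 x y ^+ 2 = f x * f y * rho1 x y ^+ 2].

(* d(rho2)/d(rho1); existence and uniqueness, for Moebius equivalent separating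
   functions on a space with at least four points, are [derivativeP] and
   [derivative_unique] below. *)
Definition derivative (R : realType) (Z : topologicalType)
    (rho1 rho2 : Z -> Z -> R) : Z -> R :=
  xget (fun=> 1) [set f | is_derivative rho1 rho2 f].

Definition antipodal (R : realType) (Z : topologicalType)
    (rho : Z -> Z -> R) : Prop :=
  [/\ separating rho,
      sup [set r | exists x y, r = rho x y] = 1 &
      forall x, exists y, rho x y = 1].

Record antipodalSpace (R : realType) := AntipodalSpace {
  apt :> topologicalType ;
  apt_compact : compact [set: apt] ;
  apt_metrizable : metrizable R apt ;
  apt_four : exists s : seq apt, uniq s /\ size s = 4%N ;
  apt_fun : apt -> apt -> R ;
  apt_antipodal : antipodal apt_fun }.

Definition quasi_metric (R : realType) (Z : antipodalSpace R) : Prop :=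
  exists2 K : R, 1 <= K & forall x y z : Z,
    apt_fun x y <= K * Num.max (apt_fun x z) (apt_fun z y).

Section derivative_theory.
Context {R : realType} {Z : topologicalType}.
Implicit Types (rho : Z -> Z -> R) (f : Z -> R).

Lemma separating_gt0 rho x y : separating rho -> x != y -> 0 < rho x y.
Proof.
case=> _ ge0 _ eq0 /eqP xy; rewrite lt_neqAle ge0 andbT eq_sym.
by apply/eqP => /eq0.
Qed.

Lemma separating_cts rho y : separating rho -> continuous (rho ^~ y).
Proof.
case=> c _ _ _ x; apply: (@cvg_comp _ _ _ (fun x => (x, y))
  (fun p : Z * Z => rho p.1 p.2) _ _ _ _ (c (x, y))).
by apply: cvg_pair => /=; [exact: cvg_id|exact: cvg_cst].
Qed.

Lemma four_fresh (s : seq Z) : (exists s : seq Z, uniq s /\ size s = 4%N) ->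
  (size s < 4)%N -> exists x, x \notin s.
Proof.
move=> [t [ut st]] ss; apply: contrapT => h.
have ts : {subset t <= s}.
  by move=> x _; apply: contrapT => /negP xs; apply: h; exists x.
by have := uniq_leq_size ut ts; rewrite st leqNgt ss.
Qed.

Context (four : exists s : seq Z, uniq s /\ size s = 4%N).

Lemma derivative_unique rho1 rho2 f g :
  separating rho1 -> is_derivative rho1 rho2 f -> is_derivative rho1 rho2 g ->
  f = g.
Proof.
move=> s1 [_ f0 fE] [_ g0 gE]; apply/funext => x.
have [y] := four_fresh four (s := [:: x]) isT.
rewrite inE => yx.
have [z] := four_fresh four (s := [:: x; y]) isT.
rewrite !inE negb_or => /andP[zx zy].
have H u v : u != v -> f u * f v = g u * g v.
  move=> uv; have := separating_gt0 s1 uv => r0.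
  have /mulIf := lt0r_neq0 (exprn_gt0 2 r0); apply.
  by rewrite -fE -gE.
have xy := H x y; have xz := H x z; have yz := H y z.
rewrite eq_sym yx in xy; rewrite eq_sym zx in xz; rewrite eq_sym zy in yz.
move: (xy isT) (xz isT) (yz isT) => {xy xz yz} xy xz yz.
have : f x ^+ 2 = g x ^+ 2.
  have /mulIf := lt0r_neq0 (mulr_gt0 (f0 y) (f0 z)); apply.
  rewrite {2}yz; transitivity ((f x * f y) * (f x * f z)); first by ring.
  by rewrite xy xz; ring.
by move/eqP; rewrite eqrXn2 ?ltW// => /eqP.
Qed.

Lemma is_derivative_ex rho1 rho2 : separating rho1 -> separating rho2 ->
  moebius_equivalent rho1 rho2 -> exists f, is_derivative rho1 rho2 f.
Proof.
move=> s1 s2 me.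
pose r x y := rho2 x y / rho1 x y.
have r0 x y : x != y -> 0 < r x y.
  by move=> xy; rewrite divr_gt0 ?separating_gt0.
have rC x y : r x y = r y x by case: s1 s2 => [_ _ c1 _] [_ _ c2 _]; rewrite /r c1 c2.
pose F x y z := r x y * r x z / r y z.
have FC x y z : F x y z = F x z y by rewrite /F (rC y z) (mulrC (r x y)).
have F1 x y z t : uniq [:: x; y; z; t] -> F x y z = F x y t.
  move=> u; have := me x y z t u; move: u.
  rewrite /= !inE !negb_or => /and4P[/and3P[xy xz xt] /andP[yz yt] zt _].
  have nz a b : a != b -> (rho1 a b != 0) /\ (rho2 a b != 0).
    by move=> ab; split; rewrite lt0r_neq0// separating_gt0.
  have [a1 a2] := nz _ _ xy; have [b1 b2] := nz _ _ xz.
  have [c1 c2] := nz _ _ xt; have [d1 d2] := nz _ _ yz.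
  have [e1 e2] := nz _ _ yt.
  rewrite /cross_ratio /F /r => E.
  have E' : rho1 x z * rho1 y t * (rho2 x t * rho2 y z) =
            rho2 x z * rho2 y t * (rho1 x t * rho1 y z).
    by apply/eqP; rewrite -eqr_div ?mulf_neq0//; apply/eqP.
  have -> : rho2 x y / rho1 x y * (rho2 x z / rho1 x z) / (rho2 y z / rho1 y z) =
    rho2 x y / rho1 x y * ((rho2 x z * rho1 y z) / (rho1 x z * rho2 y z)).
    by field; rewrite a1 b1 d1 d2.
  have -> : rho2 x y / rho1 x y * (rho2 x t / rho1 x t) / (rho2 y t / rho1 y t) =
    rho2 x y / rho1 x y * ((rho2 x t * rho1 y t) / (rho1 x t * rho2 y t)).
    by field; rewrite a1 c1 e1 e2.
  congr (_ * _); apply/eqP; rewrite eqr_div ?mulf_neq0//; apply/eqP.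
  by transitivity (rho2 x z * rho2 y t * (rho1 x t * rho1 y z));
    [ring|rewrite -E'; ring].
have F2 x y z t : x != y -> x != z -> y != z -> x != t -> y != t ->
    F x y z = F x y t.
  move=> xy xz yz xt yt; have [->//|zt] := eqVneq z t.
  by apply: F1; rewrite /= !inE !negb_or xy xz xt yz yt zt.
have F3 x y z y' z' : uniq [:: x; y; z] -> uniq [:: x; y'; z'] ->
    F x y z = F x y' z'.
  rewrite /= !inE !negb_or => /and3P[/andP[xy xz] yz _].
  move=> /and3P[/andP[xy' xz'] yz' _].
  have [yy'|yy'] := eqVneq y y'.
    by rewrite -yy'; apply: F2 => //; rewrite yy'.
  rewrite (@F2 x y z y')// FC (@F2 x y' y z')//.
  by rewrite eq_sym.
have ptx x : exists p : Z * Z, uniq [:: x; p.1; p.2].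
  have [y] := four_fresh four (s := [:: x]) isT.
  rewrite inE => yx.
  have [z] := four_fresh four (s := [:: x; y]) isT.
  rewrite !inE negb_or => /andP[zx zy].
  by exists (y, z); rewrite /= !inE !negb_or !(eq_sym x) yx zx eq_sym zy.
have [p pP] := choice ptx.
pose f x := F x (p x).1 (p x).2.
have fE x y z : uniq [:: x; y; z] -> f x = F x y z.
  by move=> u; apply: F3 u; exact: pP.
have F0 x y z : uniq [:: x; y; z] -> 0 < F x y z.
  rewrite /= !inE !negb_or => /and3P[/andP[xy xz] yz _].
  by apply: divr_gt0; [apply: mulr_gt0; exact: r0|exact: r0].
exists f; split.
- move=> x; have := pP x; set y := (p x).1; set z := (p x).2.
  rewrite /= !inE !negb_or => /and3P[/andP[xy xz] yz _].
  have rcts w : x != w -> {for x, continuous (fun x => r x w)}.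
    move=> xw; apply: cvgM; first exact: separating_cts.
    by apply: cvgV; [rewrite lt0r_neq0// separating_gt0|exact: separating_cts].
  have nbh w : x != w -> \forall x' \near x, x' != w.
    move=> xw; have : \forall x' \near x, 0 < rho1 x' w.
      have rx := separating_gt0 s1 xw.
      by have := @separating_cts _ w s1 x _ (lt_nbhsr rx).
    apply: filterS => x' x'w; apply: contraTneq x'w => ->.
    by case: s1 => _ _ _ /(_ w w)[_ ->//]; rewrite ltxx.
  have E : \forall x' \near x, F x' y z = f x'.
    near=> x'; rewrite (@fE x' y z)// /= !inE !negb_or yz andbT.
    by rewrite andbT; apply/andP; split; near: x'; exact: nbh.
  rewrite /prop_for /continuous_at.
  rewrite (fE x y z) ?/= ?inE ?negb_or ?xy ?xz ?yz//.
  apply: cvg_trans (near_eq_cvg E) _.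
  by apply: cvgM; [apply: cvgM; exact: rcts|exact: cvg_cst].
- by move=> x; apply: F0; exact: pP.
- move=> x y; have [<-|xy] := eqVneq x y.
    case: s1 s2 => [_ _ _ e1] [_ _ _ e2].
    by rewrite (e1 x x).2// (e2 x x).2// expr0n/= mulr0.
  have [z] := four_fresh four (s := [:: x; y]) isT.
  rewrite !inE negb_or => /andP[zx zy].
  rewrite (@fE x y z) ?(@fE y x z); first last.
  - by rewrite /= !inE !negb_or xy !(eq_sym _ z) zx zy.
  - by rewrite /= !inE !negb_or (eq_sym y x) xy !(eq_sym _ z) zx zy.
  have xz : x != z by rewrite eq_sym.
  have yz : y != z by rewrite eq_sym.
  have -> : F x y z * F y x z = r x y ^+ 2.
    rewrite /F (rC y x); field.
    by rewrite !lt0r_neq0 ?r0.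
  by rewrite -exprMn /r divfK// lt0r_neq0// separating_gt0.
Unshelve. all: by end_near. Qed.

Lemma derivativeP rho1 rho2 : separating rho1 -> separating rho2 ->
  moebius_equivalent rho1 rho2 ->
  is_derivative rho1 rho2 (derivative rho1 rho2).
Proof.
move=> s1 s2 me; have [f Pf] := is_derivative_ex s1 s2 me.
exact: (xgetI (fun=> 1) Pf).
Qed.

Lemma derivativeE rho1 rho2 f : separating rho1 ->
  is_derivative rho1 rho2 f -> derivative rho1 rho2 = f.
Proof.
move=> s1 Pf; apply: (derivative_unique s1 _ Pf).
exact: (xgetI (fun=> 1) Pf).
Qed.

End derivative_theory.

Record moebius_space (R : realType) (Z : antipodalSpace R) := MoebiusSpace {
  ms_fun :> Z -> Z -> R ;
  ms_antipodal : antipodal ms_fun ;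
  ms_equivalent : moebius_equivalent (@apt_fun R Z) ms_fun }.

HB.instance Definition _ (R : realType) (Z : antipodalSpace R) :=
  gen_eqMixin (moebius_space Z).
HB.instance Definition _ (R : realType) (Z : antipodalSpace R) :=
  gen_choiceMixin (moebius_space Z).

Definition moebius_dist (R : realType) (Z : antipodalSpace R)
    (rho1 rho2 : moebius_space Z) : R :=
  sup [set `|ln (derivative rho1 rho2 x)| | x in [set: Z]].

Section moebius_metric.
Context {R : realType} {Z : antipodalSpace R}.
Implicit Types rho : moebius_space Z.

Let sep rho : separating rho. Proof. by have [] := ms_antipodal rho. Qed.

Let derP rho1 rho2 : is_derivative rho1 rho2 (derivative rho1 rho2).
Proof.
apply: derivativeP; [exact: apt_four|exact: sep|exact: sep|].
by move=> x x' y y' u; rewrite -!ms_equivalent.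
Qed.

Let derE rho1 rho2 f : is_derivative rho1 rho2 f -> derivative rho1 rho2 = f.
Proof. by apply: derivativeE; [exact: apt_four|exact: sep]. Qed.

Let der_gt0 rho1 rho2 x : 0 < derivative rho1 rho2 x.
Proof. by have [] := derP rho1 rho2. Qed.

Let dist_set rho1 rho2 : set R :=
  [set `|ln (derivative rho1 rho2 x)| | x in [set: Z]].

Let dist_has_sup rho1 rho2 : has_sup (dist_set rho1 rho2).
Proof.
apply: compact_has_sup.
  have [[|x s] [_ ?]] := apt_four Z; first by [].
  by exists `|ln (derivative rho1 rho2 x)|; exists x.
apply: continuous_compact; last exact: apt_compact.
apply: continuous_subspaceT => x; apply: cvg_norm.
apply: (@continuous_comp _ _ _ (derivative rho1 rho2) (@ln R)).
  by have [c _ _] := derP rho1 rho2; exact: c.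
exact: continuous_ln.
Qed.

Let dist_ub rho1 rho2 x :
  `|ln (derivative rho1 rho2 x)| <= moebius_dist rho1 rho2.
Proof. by apply: (sup_upper_bound (dist_has_sup _ _)); exists x. Qed.

Let dist_le rho1 rho2 c :
  (forall x, `|ln (derivative rho1 rho2 x)| <= c) -> moebius_dist rho1 rho2 <= c.
Proof.
move=> h; apply: ge_sup; first by have [] := dist_has_sup rho1 rho2.
by move=> _ [x _ <-].
Qed.

Let dist_ge0 rho1 rho2 : 0 <= moebius_dist rho1 rho2.
Proof.
have [[|x s] [_ ?]] := apt_four Z; first by [].
by apply: le_trans (dist_ub rho1 rho2 x); exact: normr_ge0.
Qed.

Lemma moebius_distxx rho : moebius_dist rho rho = 0.
Proof.
apply/eqP; rewrite eq_le dist_ge0 andbT; apply: dist_le => x.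
rewrite (@derE rho rho (fun=> 1)) ?ln1 ?normr0//.
by split=> [y|y|y z]; [exact: cvg_cst|exact: ltr01|rewrite !mul1r].
Qed.

Lemma moebius_dist_eq0 rho1 rho2 : moebius_dist rho1 rho2 = 0 -> rho1 = rho2.
Proof.
move=> d0.
have E x : derivative rho1 rho2 x = 1.
  have := dist_ub rho1 rho2 x; rewrite d0 normr_le0 ln_eq0 ?der_gt0//.
  by move/eqP.
have : ms_fun rho1 = ms_fun rho2.
  apply/funext => x; apply/funext => y.
  have [_ _ /(_ x y)] := derP rho1 rho2; rewrite !E !mul1r => /esym/eqP.
  have [_ p1 _ _] := sep rho1; have [_ p2 _ _] := sep rho2.
  by rewrite eqrXn2 ?p1 ?p2// => /eqP.
case: rho1 rho2 {d0 E} => [f1 a1 e1] [f2 a2 e2] /= f12; subst f2.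
by congr MoebiusSpace; exact: Prop_irrelevance.
Qed.

Let dist_sym_le rho1 rho2 : moebius_dist rho1 rho2 <= moebius_dist rho2 rho1.
Proof.
apply: dist_le => x; have [c p e] := derP rho2 rho1.
rewrite (@derE rho1 rho2 (fun x => (derivative rho2 rho1 x)^-1)).
  by rewrite lnV ?posrE ?der_gt0// normrN.
split=> [y|y|y z]; [|by rewrite invr_gt0 ?der_gt0|].
  by apply: cvgV; [rewrite lt0r_neq0 ?der_gt0|exact: c].
by rewrite e; field; rewrite !lt0r_neq0 ?der_gt0.
Qed.

Lemma moebius_dist_sym rho1 rho2 :
  moebius_dist rho1 rho2 = moebius_dist rho2 rho1.
Proof. by apply/eqP; rewrite eq_le !dist_sym_le. Qed.

Lemma moebius_dist_triangle rho2 rho1 rho3 :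
  moebius_dist rho1 rho3 <= moebius_dist rho1 rho2 + moebius_dist rho2 rho3.
Proof.
apply: dist_le => x.
have [c p e] := derP rho1 rho2; have [c' p' e'] := derP rho2 rho3.
rewrite (@derE rho1 rho3
  (fun x => derivative rho1 rho2 x * derivative rho2 rho3 x)).
  rewrite lnM ?posrE ?der_gt0//; apply: le_trans (ler_normD _ _) _.
  by apply: lerD; exact: dist_ub.
split=> [y|y|y z]; [|by rewrite mulr_gt0 ?der_gt0|].
  by apply: cvgM; [exact: c|exact: c'].
by rewrite e' e; ring.
Qed.

HB.instance Definition _ := isMetric.Build R (moebius_space Z)
  moebius_distxx moebius_dist_eq0 moebius_dist_sym moebius_dist_triangle.

Lemma mdist_moebiusE rho1 rho2 : mdist rho1 rho2 = moebius_dist rho1 rho2.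
Proof. by []. Qed.

End moebius_metric.

Definition geodesic_on (R : realType) (X : metricType R) (I : set R)
    (c : R -> X) : Prop :=
  forall s t, I s -> I t -> mdist (c s) (c t) = `|s - t|.

Definition proper_space (R : realType) (X : metricType R) : Prop :=
  forall (x : X) (r : R), compact [set y : X | mdist x y <= r].

Definition geodesic_space (R : realType) (X : metricType R) : Prop :=
  forall x y : X, exists (L : R) (c : R -> X),
    [/\ 0 <= L, geodesic_on `[0, L] c, c 0 = x & c L = y].

Definition geodesically_complete (R : realType) (X : metricType R) : Prop :=
  forall (a b : R) (c : R -> X), a <= b -> geodesic_on `[a, b] c ->
    exists2 c' : R -> X, geodesic_on setT c' &
      forall t, a <= t <= b -> c' t = c t.

Definition gromov_product (R : realType) (X : metricType R) (p x y : X) : R :=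
  (mdist p x + mdist p y - mdist x y) / 2.

Definition gromov_hyperbolic (R : realType) (X : metricType R) : Prop :=
  exists delta : R, forall p x y z : X,
    Num.min (gromov_product p x y) (gromov_product p y z) - delta
      <= gromov_product p x z.

(* A ray is a function on all of R of which only the restriction to [0, +oo[
   matters. *)
Definition geodesic_ray (R : realType) (X : metricType R) (c : R -> X) : Prop :=
  geodesic_on `[0, +oo[ c.

Definition asymptotic (R : realType) (X : metricType R) (c c' : R -> X) : Prop :=
  exists M : R, forall t, 0 <= t -> mdist (c t) (c' t) <= M.

Record boundary (R : realType) (X : metricType R) := Boundary {
  bd_class :> set (R -> X) ;
  bd_classP : exists2 c, geodesic_ray c &
    bd_class = [set c' | geodesic_ray c' /\ asymptotic c c'] }.

HB.instance Definition _ (R : realType) (X : metricType R) :=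
  gen_eqMixin (boundary X).
HB.instance Definition _ (R : realType) (X : metricType R) :=
  gen_choiceMixin (boundary X).

Variant compactification (R : realType) (X : metricType R) :=
  | Inner of X
  | Ideal of boundary X.
Arguments Inner {R X}.
Arguments Ideal {R X}.

HB.instance Definition _ (R : realType) (X : metricType R) :=
  gen_eqMixin (compactification X).
HB.instance Definition _ (R : realType) (X : metricType R) :=
  gen_choiceMixin (compactification X).

(* Generalized rays, as in Bridson-Haefliger III.H.3: a generalized ray from p
   to a point of X is a geodesic segment, extended by a constant. *)
Definition generalized_ray (R : realType) (X : metricType R) (p : X)
    (z : compactification X) (c : R -> X) : Prop :=
  c 0 = p /\
  match z with
  | Inner x => exists L : R,
      [/\ 0 <= L, geodesic_on `[0, L] c & forall t, L <= t -> c t = x]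
  | Ideal xi => geodesic_ray c /\ bd_class xi c
  end.

(* Convergence of sequences in the cone topology (Bridson-Haefliger III.H,
   3.5).  There a basepoint p is fixed; for proper geodesic hyperbolic spaces
   the choice of p is irrelevant, and we ask for all of them. *)
Definition cone_cvg (R : realType) (X : metricType R)
    (z_ : nat -> compactification X) (z : compactification X) : Prop :=
  forall p : X, exists2 c : nat -> R -> X,
    forall n, generalized_ray p (z_ n) (c n) &
    forall phi : nat -> nat, increasing_seq phi ->
      exists2 psi : nat -> nat, increasing_seq psi &
      exists2 c' : R -> X, generalized_ray p z c' &
      forall K : set R, compact K -> K `<=` `[0, +oo[ ->
        {uniform K, (fun n => c (phi (psi n))) @ \oo --> c'}.

(* The closed sets are the sequentially closed ones. *)
Definition cone_closed (R : realType) (X : metricType R)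
    (B : set (compactification X)) : Prop :=
  forall z_ z, (forall n, B (z_ n)) -> cone_cvg z_ z -> B z.

Section cone_topology.
Context {R : realType} {X : metricType R}.
Implicit Types U V : set (compactification X).

Let cone_open U := cone_closed (~` U).

Let cone_cvg_sub z_ (z : compactification X) (sigma : nat -> nat) :
  increasing_seq sigma ->
  cone_cvg z_ z -> cone_cvg (z_ \o sigma) z.
Proof.
move=> isig + p => /(_ p)[c cP cphi]; exists (c \o sigma).
  by move=> n; exact: cP.
move=> phi iphi; apply: (cphi (sigma \o phi)) => m n.
exact: etrans (isig _ _) (iphi _ _).
Qed.

Let cone_openT : cone_open setT.
Proof. by move=> z_ z /(_ 0%N); rewrite setCT. Qed.

Let infinite_sub (P : nat -> Prop) : (forall n, exists2 m, (n <= m)%N & P m) ->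
  exists2 sigma : nat -> nat, increasing_seq sigma & forall n, P (sigma n).
Proof.
move=> h; have {}h n : exists m, (n <= m)%N /\ P m.
  by have [m nm Pm] := h n; exists m.
have [g gP] := choice h.
exists (fun n => iter n (g \o succn) (g 0%N)).
  apply/increasing_seqP => n /=.
  by have [] := gP (iter n (g \o succn) (g 0%N)).+1.
by elim=> [|n _] /=; apply (gP _).2.
Qed.

Let cone_openI : setI_closed cone_open.
Proof.
move=> U V oU oV z_ z zUV zc [Uz Vz].
have [[N hN]|h] := pselect (exists N, forall m, (N <= m)%N -> U (z_ m)).
- apply: (oV (z_ \o addn N) z) => //.
    move=> n Vn; apply: (zUV (N + n)%N); split => //.
    by apply: hN; rewrite leq_addr.
  by apply: cone_cvg_sub zc => m n /=; exact: leq_add2l.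
- have [|sigma isig sigU] := @infinite_sub (fun m => ~ U (z_ m)).
    move=> n; apply: contrapT => h'; apply: h; exists n => m nm.
    by apply: contrapT => Um; apply: h'; exists m.
  by apply: (oU (z_ \o sigma) z) => //; exact: cone_cvg_sub zc.
Qed.

Let cone_open_bigU (I : Type) (f : I -> set (compactification X)) :
  (forall i, cone_open (f i)) -> cone_open (\bigcup_i f i).
Proof.
move=> h z_ z zn zc [i _ fz]; apply: (h i z_ z) => // n fi.
by apply: (zn n); exists i.
Qed.

HB.instance Definition _ := isOpenTopological.Build (compactification X)
  cone_openT cone_openI cone_open_bigU.

Lemma closed_coneE (B : set (compactification X)) : closed B = cone_closed B.
Proof. by rewrite -openC -[in RHS](setCK B) propeqE; split. Qed.

HB.instance Definition _ :=
  Topological.copy (boundary X) (initial_topology (@Ideal R X)).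

End cone_topology.

Definition is_gromov_extension (R : realType) (X : metricType R) (p : X)
    (f : compactification X * compactification X -> \bar R) : Prop :=
  [/\ continuous f, forall z, (0 <= f z)%E &
      forall x y : X, f (Inner x, Inner y) = (gromov_product p x y)%:E].

Definition gromov_extension (R : realType) (X : metricType R) (p : X) :
    compactification X * compactification X -> \bar R :=
  xget (fun=> 0%E) [set f | is_gromov_extension p f].

Definition boundary_continuous (R : realType) (X : metricType R) : Prop :=
  forall p : X, exists f, is_gromov_extension p f.

Definition visual_fun (R : realType) (X : metricType R) (p : X)
    (xi eta : boundary X) : R :=
  fine (expeR (- gromov_extension p (Ideal xi, Ideal eta))%E).

Definition moebius_map (R : realType) (Y X : metricType R)
    (g : boundary Y -> boundary X) : Prop :=
  forall (q : Y) (p : X) (x x' y y' : boundary Y), uniq [:: x; x'; y; y'] ->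
    cross_ratio (visual_fun p) (g x) (g x') (g y) (g y')
    = cross_ratio (visual_fun q) x x' y y'.

Definition homeomorphism (S T : topologicalType) (g : S -> T) : Prop :=
  continuous g /\ exists h : T -> S, [/\ continuous h, cancel g h & cancel h g].

Definition compactification_map (R : realType) (Y X : metricType R)
    (G : Y -> X) (g : boundary Y -> boundary X) (z : compactification Y) :
    compactification X :=
  match z with
  | Inner y => Inner (G y)
  | Ideal xi => Ideal (g xi)
  end.

Record good_gromov_hyperbolic (R : realType) (X : metricType R) : Prop := {
  good_proper : proper_space X ;
  good_geodesic : geodesic_space X ;
  good_complete : geodesically_complete X ;
  good_hyperbolic : gromov_hyperbolic X ;
  good_boundary_continuous : boundary_continuous X }.

Definition maximal_gromov_hyperbolic (R : realType) (X : metricType R) : Prop :=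
  good_gromov_hyperbolic X /\
  forall Y : metricType R, good_gromov_hyperbolic Y ->
  forall g : boundary Y -> boundary X, homeomorphism g -> moebius_map g ->
  exists G : Y -> X, (forall x y, mdist (G x) (G y) = mdist x y) /\
    continuous (compactification_map G g).

(* Main.v *)
Require Import Defs.
From mathcomp Require Import all_boot all_order all_algebra.
From mathcomp Require Import all_classical all_reals all_analysis.
From mathcomp Require Import ring lra.

Set Implicit Arguments.
Unset Strict Implicit.
Unset Printing Implicit Defensive.

Import Order.TTheory GRing.Theory Num.Theory.
Import numFieldNormedType.Exports.

Local Open Scope classical_set_scope.
Local Open Scope ring_scope.

(** Why the theorem holds.

    Write an element rho of the Moebius space as
    rho(x, y) = alpha(x, y) e^{- f(x) - f(y)}, where f (here [mcoord rho]) is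
    minus half the logarithm of the derivative of rho with respect to alpha.
    That rho is antipodal means f(x) = max_y (ln alpha(x, y) - f(y)) for
    every x: in the terminology of Isbell and Dress, f is an extremal function
    for the kernel ln alpha.  The Moebius metric is twice the uniform distance
    of the coordinates.  The Moebius space is therefore a tight span, with the
    peculiarity that the kernel is -oo on the diagonal, and the proof is the
    geometry of tight spans.

    Geodesics and rays.  Dress's iteration, which averages f with its conjugate,
    produces a 1-Lipschitz retraction of the admissible functions onto the
    extremal ones ([retraction]).  Any 1-Lipschitz path of admissible functions
    can be pushed through it: straight segments give geodesics
    ([moebius_geodesic]), and the paths built from [ray_profile] give, from
    every point, a ray along which the coordinate at a prescribed point xi drops
    at maximal speed ([exists_ray]).  On a segment from p to q there are antipodal points xi and
    eta at which the coordinate changes at maximal speed, so a ray from q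
    towards xi and one from p towards eta prolong it ([moebius_complete]).

    Properness and hyperbolicity.  A bound on an extremal function bounds its
    modulus of continuity, so balls are compact by Arzela-Ascoli
    ([moebius_proper]).  Half the distance of e and q is the maximum over
    (x, y) of ln alpha(x, y) - e(x) - q(y), so the four-point inequality of the
    kernel, a consequence of the quasi-metric inequality, passes to the Moebius
    space ([moebius_hyperbolic]).

    Boundary.  Along a geodesic ray the coordinate drops at maximal speed at
    exactly one point of Z, and two rays are asymptotic if and only if these
    points agree; this identifies the boundary with Z ([endpoint_inj],
    [endpoint_surj]).  A point z of the compactification is determined by its
    shadow x |-> e^{-(z|x)}, a function on Z, and cone convergence amounts to
    convergence of shadows ([shadow_ray_limit], [shadow_cone_cvg]).  The
    exponential e^{-(z|w)} is a bilinear expression, over the semiring of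
    nonnegative reals with max and product, of which the shadows are the
    partial evaluations; hence it is 1-Lipschitz in the shadows and extends
    continuously to the compactification ([moebius_gromovP]).

    Maximality.  Let g be a Moebius homeomorphism from the boundary of Y.  The
    functions e^{-(.|.)_y}, transported to Z, are antipodal because rays of Y
    extend to lines, and they are Moebius equivalent to alpha.  This defines G
    from Y to the Moebius space.  The logarithmic derivatives are the Busemann
    functions of Y, whose uniform norm is the distance because segments extend
    to rays; so G is isometric.  The shadow of the image of z is, up to a
    factor independent of the point of Z and a fixed positive function, the
    function e^{-(z|.)_y}, which depends continuously on z since Y is boundary
    continuous; so G extends continuously by g ([moebius_extension]). *)

(** * Extremal functions and the retraction onto them *)

Section extremal_functions.
Context {R : realType} {T : Type}.
Variable alpha : T -> T -> R.
Implicit Types (f g : T -> R) (x y : T) (c : R).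

Definition uniformly_bounded f : Prop := exists C : R, forall x, `|f x| <= C.

Definition admissible f : Prop := forall x y, alpha x y <= expR (f x + f y).

(** That is, f x is the supremum over y of ln (alpha x y) - f y.  Exponentials
    replace the logarithm because [alpha] vanishes on the diagonal. *)
Definition extremal f : Prop :=
  admissible f /\
  forall x c, (forall y, alpha x y <= expR (c + f y)) -> f x <= c.

Hypothesis alpha_le1 : forall x y, alpha x y <= 1.
Hypothesis alpha_sym : forall x y, alpha x y = alpha y x.
Hypothesis alpha_antip : forall x, exists y, alpha x y = 1.

Definition conjugate f x : R := ln (sup [set alpha x y * expR (- f y) | y in setT]).

Let conj_sup f x : uniformly_bounded f ->
  has_sup [set alpha x y * expR (- f y) | y in setT].
Proof.
move=> [C fC]; split.
  by have [y _] := alpha_antip x; exists (alpha x y * expR (- f y)); exists y.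
exists (expR C) => _ [y _ <-].
rewrite -[leRHS]mul1r; apply: le_trans (ler_wpM2r (expR_ge0 _) (alpha_le1 x y)) _.
by rewrite !mul1r ler_expR; have := fC y; rewrite ler_norml; lra.
Qed.

Let conj_gt0 f x : uniformly_bounded f ->
  0 < sup [set alpha x y * expR (- f y) | y in setT].
Proof.
move=> bf; have [y a1] := alpha_antip x.
apply: (@lt_le_trans _ _ (alpha x y * expR (- f y))).
  by rewrite a1 mul1r expR_gt0.
by apply: (sup_upper_bound (conj_sup x bf)); exists y.
Qed.

(** The Galois connection through which [conjugate] is used. *)
Lemma conjugate_leP f x c : uniformly_bounded f ->
  (forall y, alpha x y <= expR (c + f y)) <-> conjugate f x <= c.
Proof.
move=> bf; rewrite /conjugate -{2}[c]expRK ler_ln ?posrE ?conj_gt0 ?expR_gt0//.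
split=> [H|H y].
  apply: ge_sup; first by have [] := conj_sup x bf.
  move=> _ [y _ <-]; rewrite -ler_pdivlMr ?expR_gt0// -expRN opprK -expRD.
  exact: H.
rewrite expRD -ler_pdivrMr ?expR_gt0// -expRN; apply: le_trans H.
by apply: (sup_upper_bound (conj_sup x bf)); exists y.
Qed.

Lemma conjugateP f x y : uniformly_bounded f -> alpha x y <= expR (conjugate f x + f y).
Proof. by move=> bf; apply: (conjugate_leP x _ bf).2. Qed.

Lemma conjugate_le_shift f g c : uniformly_bounded f -> uniformly_bounded g ->
  (forall x, f x <= g x + c) -> forall x, conjugate g x <= conjugate f x + c.
Proof.
move=> bf bg fg x; apply/(conjugate_leP _ _ bg) => y.
apply: le_trans (conjugateP x y bf) _; rewrite ler_expR.
by have := fg y; lra.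
Qed.

Lemma conjugate_ge f C : uniformly_bounded f -> (forall x, f x <= C) ->
  forall x, - C <= conjugate f x.
Proof.
move=> bf fC x; have [y a1] := alpha_antip x.
have := conjugateP x y bf; rewrite a1 -expR0 ler_expR.
by have := fC y; lra.
Qed.

Lemma admissible_conjugate f : uniformly_bounded f -> admissible f ->
  forall x, conjugate f x <= f x.
Proof. by move=> bf af x; apply/(conjugate_leP _ _ bf) => y. Qed.

(** Averaging with the conjugate keeps admissibility, because each of the two
    mixed terms f x + conjugate f y and f y + conjugate f x bounds
    ln (alpha x y), and it halves the gap to the conjugate. *)
Definition halfway f x : R := (f x + conjugate f x) / 2.

Let ok f := uniformly_bounded f /\ admissible f.

Let ok_halfway f : ok f -> ok (halfway f).
Proof.
move=> [bf af]; split.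
  have [C fC] := bf; exists C => x.
  have := admissible_conjugate bf af x.
  have := conjugate_ge bf (fun x => le_trans (ler_norm _) (fC x)) x.
  by have := fC x; rewrite !ler_norml /halfway; lra.
move=> x y.
have := conjugateP x y bf; have := conjugateP y x bf; rewrite (alpha_sym y x).
have [a0|a0] := leP (alpha x y) 0; first by move=> *; apply: le_trans a0 (expR_ge0 _).
rewrite -{1 2 3}(@lnK _ (alpha x y)) ?posrE// !ler_expR /halfway.
lra.
Qed.

Let it n f := iter n halfway f.

Let ok_it n f : ok f -> ok (it n f).
Proof. by elim: n => [//|n IH] /IH; exact: ok_halfway. Qed.

Let it_decr n f x : ok f -> it n.+1 f x <= it n f x.
Proof.
move=> /(ok_it n)[b a]; have := admissible_conjugate b a x.
by rewrite /= /halfway; lra.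
Qed.

Let it_conj n f x : ok f -> conjugate (it n f) x <= conjugate (it n.+1 f) x.
Proof.
move=> okf; have [b a] := ok_it n okf; have [b' _] := ok_it n.+1 okf.
have := @conjugate_le_shift (it n.+1 f) (it n f) 0 b' b.
move=> /(_ (fun x => le_trans (it_decr n x okf) _)) H.
by have := H (fun x => ltac:(by rewrite addr0)) x; rewrite addr0.
Qed.

(* The iterates decrease, their conjugates increase, and every conjugate lies
   below every iterate. *)
Let it_conj_le n m f x : ok f -> conjugate (it n f) x <= it m f x.
Proof.
move=> okf; have H k : conjugate (it k f) x <= it k f x.
  by have [b a] := ok_it k okf; exact: admissible_conjugate.
have [nm|/ltnW mn] := leqP n m.
  apply: le_trans (H m); elim: m nm => [|m IH]; first by rewrite leqn0 => /eqP->.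
  rewrite leq_eqVlt => /predU1P[->//|]; rewrite ltnS => /IH h.
  exact: le_trans h (it_conj m x okf).
apply: le_trans (H n) _; elim: n mn => [|n IH]; first by rewrite leqn0 => /eqP->.
rewrite leq_eqVlt => /predU1P[<-//|]; rewrite ltnS => /IH h.
exact: le_trans (it_decr n x okf) h.
Qed.

Let it_gap n f C : ok f -> (forall x, `|f x| <= C) ->
  forall x, it n f x - conjugate (it n f) x <= 2 * C / 2 ^+ n.
Proof.
move=> okf fC; elim: n => [|n IH] x.
  have := conjugate_ge okf.1 (fun x => le_trans (ler_norm _) (fC x)) x.
  by rewrite expr0 divr1 /=; have := fC x; rewrite ler_norml; lra.
have := it_conj n x okf; have := IH x; rewrite exprS invfM /= /halfway.
lra.
Qed.

(** Limit of Dress's iteration. *)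
Definition retraction f x : R := inf [set iter n halfway f x | n in setT].

Let retr_inf f x : ok f -> has_inf [set it n f x | n in setT].
Proof.
move=> okf; split; first by exists (f x); exists 0%N.
by exists (conjugate f x) => _ [n _ <-]; exact: (it_conj_le 0 n).
Qed.

Let retr_le f n x : ok f -> retraction f x <= it n f x.
Proof. by move=> okf; apply: (ge_inf (retr_inf x okf).2); exists n. Qed.

Let retr_ge f x c : ok f -> (forall n, c <= it n f x) -> c <= retraction f x.
Proof.
move=> okf H; apply: (lb_le_inf (retr_inf x okf).1).
by move=> _ [n _ <-]; exact: H.
Qed.

Lemma retraction_le f : uniformly_bounded f -> admissible f ->
  forall x, retraction f x <= f x.
Proof. by move=> bf af x; exact: (@retr_le f 0%N). Qed.

Lemma retraction_bounded f : uniformly_bounded f -> admissible f ->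
  uniformly_bounded (retraction f).
Proof.
move=> bf af; have [C fC] := bf; exists C => x.
have okf : ok f by [].
have := retraction_le bf af x.
have := retr_ge okf (fun n => it_conj_le 0 n x okf).
have := conjugate_ge bf (fun x => le_trans (ler_norm _) (fC x)) x.
by have := fC x; rewrite !ler_norml /=; lra.
Qed.

Let retr_adm f : ok f -> admissible (retraction f).
Proof.
move=> okf x y.
have [a0|a0] := leP (alpha x y) 0; first by apply: le_trans a0 (expR_ge0 _).
rewrite -{1}(@lnK _ (alpha x y)) ?posrE// ler_expR -lerBlDr.
apply: retr_ge => // n; rewrite lerBlDl -lerBlDr; apply: retr_ge => // m.
wlog nm : n m x y a0 / (n <= m)%N => [wl|].
  have [/wl|/ltnW/wl] := leqP n m; first exact.
  by move=> /(_ y x); rewrite (alpha_sym y x) => /(_ a0); rewrite lerBlDl -lerBlDr.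
have [_ /(_ x y)] := ok_it m okf.
rewrite -{1}(@lnK _ (alpha x y)) ?posrE// ler_expR.
suff : it m f x <= it n f x by lra.
elim: m nm => [|m IH]; first by rewrite leqn0 => /eqP->.
rewrite leq_eqVlt => /predU1P[->//|]; rewrite ltnS => /IH h.
exact: le_trans (it_decr m x okf) h.
Qed.

(** The gap between the n-th iterate and its conjugate is O(2^-n), so the limit
    equals its conjugate. *)
Lemma extremal_retraction f : uniformly_bounded f -> admissible f ->
  extremal (retraction f).
Proof.
move=> bf af; have okf : ok f by []; split; first exact: retr_adm.
move=> x c H; apply/ler_addgt0Pr => e e0; have [C fC] := bf.
have C0 : 0 <= C by apply: le_trans (fC x).
have [n ne] : exists n, 2 * C / 2 ^+ n < e.
  exists (Num.truncn (2 * C / e)).+1.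
  rewrite ltr_pdivrMr ?exprn_gt0// [ltRHS]mulrC -ltr_pdivrMr//.
  apply: lt_le_trans (truncnS_gt _) _.
  by rewrite -natrX ler_nat; apply: ltnW; exact: ltn_expl.
apply: le_trans (retr_le n x okf) _.
have := it_gap n okf fC x.
suff : conjugate (it n f) x <= c by lra.
have [bn _] := ok_it n okf; apply/(conjugate_leP _ _ bn) => y.
by apply: le_trans (H y) _; rewrite ler_expR lerD2l; exact: retr_le.
Qed.

(** Conjugation is order-reversing and commutes with constants up to sign, hence
    1-Lipschitz for the uniform distance; so are all the iterates. *)
Lemma retraction_lip f g c : uniformly_bounded f -> admissible f ->
  uniformly_bounded g -> admissible g -> (forall x, `|f x - g x| <= c) ->
  forall x, `|retraction f x - retraction g x| <= c.
Proof.
move=> bf af bg ag fg; have okf : ok f by []; have okg : ok g by [].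
have H n x : `|it n f x - it n g x| <= c.
  elim: n x => [|n IH] x; first exact: fg.
  have [bn _] := ok_it n okf; have [bn' _] := ok_it n okg.
  have h1 : conjugate (it n g) x <= conjugate (it n f) x + c.
    apply: conjugate_le_shift => // z; have := IH z; rewrite ler_norml; lra.
  have h2 : conjugate (it n f) x <= conjugate (it n g) x + c.
    apply: conjugate_le_shift => // z; have := IH z; rewrite ler_norml; lra.
  by have := IH x; rewrite !ler_norml /= /halfway; lra.
move=> x; rewrite ler_norml.
have : retraction f x - c <= retraction g x.
  apply: retr_ge => // n; have := retr_le n x okf; have := H n x.
  by rewrite ler_norml; lra.
have : retraction g x - c <= retraction f x.
  apply: retr_ge => // n; have := retr_le n x okg; have := H n x.
  by rewrite ler_norml; lra.
lra.
Qed.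

Lemma extremal_le f g : extremal f -> admissible g ->
  (forall x, g x <= f x) -> f = g.
Proof.
move=> [_ ef] ag gf; apply/funext => x; apply/eqP; rewrite eq_le gf andbT.
apply: ef => y; apply: le_trans (ag x y) _.
by rewrite ler_expR lerD2l.
Qed.

Lemma retraction_id f : uniformly_bounded f -> extremal f -> retraction f = f.
Proof.
move=> bf [af ef]; apply/esym/extremal_le => //.
- by have [] := extremal_retraction bf af.
- exact: retraction_le.
Qed.

Lemma admissible_convex f g t : 0 <= t <= 1 -> admissible f -> admissible g ->
  admissible (fun x => (1 - t) * f x + t * g x).
Proof.
move=> t01 af ag x y; have := af x y; have := ag x y.
have [a0|a0] := leP (alpha x y) 0.
  by move=> *; apply: le_trans a0 (expR_ge0 _).
rewrite -{1 2 3}(@lnK _ (alpha x y)) ?posrE// !ler_expR; nra.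
Qed.

End extremal_functions.

(** * Coordinates on the Moebius space *)

Section moebius_coordinates.
Context {R : realType} {Z : antipodalSpace R}.
Implicit Types (rho : Z -> Z -> R) (e p q : moebius_space Z) (f : Z -> R).
Implicit Types (x y z xi : Z).

Local Notation alpha := (@apt_fun R Z).

Lemma antipodal_of_le1 rho : separating rho -> (forall x y, rho x y <= 1) ->
  (forall x, exists y, rho x y = 1) -> antipodal rho.
Proof.
move=> sep le1 ex1; split => //.
have [[|x s] [_ ?]] := apt_four Z; first by [].
have [y xy] := ex1 x.
have ub : ubound [set r | exists x y, r = rho x y] 1 by move=> _ [u [v ->]].
apply/eqP; rewrite eq_le; apply/andP; split.
  by apply: ge_sup => //; exists 1, x, y.
by apply: ub_le_sup; [exists 1|exists x, y].
Qed.

Lemma antipodal_le1 rho x y : antipodal rho -> rho x y <= 1.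
Proof.
move=> [_ sup1 _]; rewrite -sup1.
have [hs|/sup_out h] := pselect (has_sup [set r | exists x y, r = rho x y]).
  by apply: (sup_upper_bound hs); exists x, y.
by have := @oner_neq0 R; rewrite -sup1 h eqxx.
Qed.

Let sepa : separating alpha. Proof. by have [] := apt_antipodal Z. Qed.

Lemma alpha_ge0 x y : 0 <= alpha x y. Proof. by have [] := sepa. Qed.

Lemma alpha_le1 x y : alpha x y <= 1.
Proof. exact: antipodal_le1 (apt_antipodal Z). Qed.

Lemma alpha_sym x y : alpha x y = alpha y x. Proof. by have [] := sepa. Qed.

Lemma alpha_eq0 x y : alpha x y = 0 <-> x = y. Proof. by have [] := sepa. Qed.

Lemma alphaxx x : alpha x x = 0. Proof. exact/alpha_eq0. Qed.

Lemma alpha_antip x : exists y, alpha x y = 1.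
Proof. by have [_ _ /(_ x)] := apt_antipodal Z. Qed.

Lemma alpha_continuous y : continuous (alpha^~ y).
Proof. exact: separating_cts. Qed.

Lemma antipodalSpace_inh : exists x : Z, True.
Proof. by have [[|x s] [_ ?]] := apt_four Z => //; exists x. Qed.

(** Compactness of Z makes the continuity of [alpha] at x uniform in the second
    variable. *)
Lemma alpha_unif_near x (r : R) : 0 < r ->
  \forall x' \near x, forall y, `|alpha x y - alpha x' y| <= r.
Proof.
move=> r0.
have H := (compact_near_coveringP _).1 (@apt_compact R Z) Z (nbhs x)
  (fun x' y => `|alpha x y - alpha x' y| <= r) _.
suff : \forall x' \near x, setT `<=` (fun y => `|alpha x y - alpha x' y| <= r).
  by apply: filterS => x' h y; exact: h.
apply: H => y _ /=.
have [c _ _ _] := sepa.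
have r2 : 0 < r / 2 by rewrite divr_gt0.
have h2 : \forall z \near y, `|alpha x y - alpha x z| < r / 2.
  have := @alpha_continuous x y; rewrite (_ : alpha^~ x = alpha x).
    by move/cvgrPdist_lt => /(_ _ r2).
  by apply/funext => z; exact: alpha_sym.
have := c (x, y); move/cvgrPdist_lt => /(_ _ r2) [[A B] /= [Ax By] AB].
exists ([set z | B z /\ `|alpha x y - alpha x z| < r / 2], A).
  by split => //=; apply: filterI.
move=> [z x'] /= [[Bz h] Ax'].
have := AB (x', z) (conj Ax' Bz) => /= h'.
rewrite (_ : alpha x z - alpha x' z =
  (alpha x y - alpha x' z) - (alpha x y - alpha x z)); last by ring.
by apply: le_trans (ler_normB _ _) _; lra.
Qed.

(** Half the logarithm, so that [alpha] and an element e differ by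
    e^{- mcoord e x - mcoord e y}; the sign makes this an extremal function. *)
Definition mcoord e x : R := - ln (derivative alpha e x) / 2.

Let sepm e : separating e. Proof. by have [] := ms_antipodal e. Qed.

Let der e : is_derivative alpha e (derivative alpha e).
Proof.
by apply: derivativeP; [exact: apt_four|exact: sepa|exact: sepm|exact: ms_equivalent].
Qed.

Let der_expR e x : derivative alpha e x = expR (- (2 * mcoord e x)).
Proof.
have [_ g0 _] := der e; rewrite /mcoord (_ : - _ = ln (derivative alpha e x)).
  by rewrite lnK ?posrE.
by field.
Qed.

Lemma mcoord_continuous e : continuous (mcoord e).
Proof.
move=> x; apply: cvgM; last exact: cvg_cst.
apply: cvgN; have [c g0 _] := der e.
by apply: (@continuous_comp _ _ _ (derivative alpha e) (@ln R));
  [exact: c|exact: continuous_ln].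
Qed.

Lemma mcoordE e x y : e x y = alpha x y * expR (- mcoord e x - mcoord e y).
Proof.
have [_ _ /(_ x y)] := der e; rewrite !der_expR -expRD => E.
have [_ e0 _ _] := sepm e.
apply/eqP; rewrite -(@eqrXn2 _ 2%N)// ?mulr_ge0 ?expR_ge0 ?alpha_ge0//.
rewrite E exprMn mulrC [X in _ == _ * X]expr2 -expRD.
by apply/eqP; congr (_ * expR _); ring.
Qed.

Lemma mcoord_bounded e : uniformly_bounded (mcoord e).
Proof.
have [x0 _] := antipodalSpace_inh.
have cn : {within setT, continuous (fun x => `|mcoord e x|)}.
  by apply: continuous_subspaceT => x; apply: cvg_norm; exact: mcoord_continuous.
have [|x _ H] := @compact_EVT_max _ _ _ setT _ (@apt_compact R Z) cn.
  by exists x0.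
by exists `|mcoord e x| => y; apply: H; rewrite inE.
Qed.

Lemma mcoord_extremal e : extremal alpha (mcoord e).
Proof.
split=> [x y|x c H].
  have := antipodal_le1 x y (ms_antipodal e); rewrite mcoordE.
  by rewrite -opprD expRN ler_pdivrMr ?expR_gt0// mul1r.
have [_ _ /(_ x)[y]] := ms_antipodal e; rewrite mcoordE => E.
have := H y; rewrite -(ler_pM2r (expR_gt0 (- mcoord e x - mcoord e y))) E.
by rewrite -expRD -expR0 ler_expR; lra.
Qed.

Lemma mcoord_antip e x : exists y, alpha x y = expR (mcoord e x + mcoord e y).
Proof.
have [_ _ /(_ x)[y]] := ms_antipodal e; rewrite mcoordE => E; exists y.
have := E; move/(congr1 (fun t => t * expR (mcoord e x + mcoord e y))).
by rewrite mul1r -mulrA -expRD (_ : _ + (_ + _) = 0) ?expR0 ?mulr1//; ring.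
Qed.

(** Extremality gives more than continuity: the oscillation of f is controlled by
    that of [alpha] and a bound of f only.  This is the equicontinuity behind
    properness. *)
Lemma extremal_modulus f C r x x' : (forall y, `|f y| <= C) ->
  extremal alpha f -> (forall y, `|alpha x y - alpha x' y| <= r) ->
  f x <= f x' + r * expR (2 * C).
Proof.
move=> fC [af ef] ar; apply: ef => y.
have r0 : 0 <= r by apply: le_trans (ar x).
apply: (@le_trans _ _ (alpha x' y + r)).
  by have := ar y; rewrite ler_norml; lra.
apply: (@le_trans _ _ (expR (f x' + f y) + r)); first by rewrite lerD2r.
apply: (@le_trans _ _ (expR (f x' + f y) * (1 + r * expR (2 * C)))); last first.
  rewrite (_ : f x' + _ + f y = (f x' + f y) + r * expR (2 * C)); last by ring.
  by rewrite [leRHS]expRD ler_wpM2l ?expR_ge0// expR_ge1Dx.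
rewrite mulrDr mulr1 lerD2l mulrCA -expRD ler_peMr// -[leLHS]expR0 ler_expR.
by have := fC x'; have := fC y; rewrite !ler_norml; lra.
Qed.

Lemma extremal_continuous f : uniformly_bounded f -> extremal alpha f -> continuous f.
Proof.
move=> [C fC] ef x; apply/cvgrPdist_le => r r0.
have r1 : 0 < r * expR (- (2 * C)) by rewrite mulr_gt0 ?expR_gt0.
apply: filterS (alpha_unif_near x r1) => x' H.
have := extremal_modulus fC ef H.
have := @extremal_modulus f C _ x' x fC ef (fun y => ltac:(rewrite distrC; exact: H y)).
rewrite -!mulrA -!expRD (_ : - (2 * C) + 2 * C = 0) ?expR0 ?mulr1; last by ring.
by rewrite ler_norml; lra.
Qed.

(** A bounded extremal function is automatically continuous, so it is the
    coordinate of an element of the Moebius space. *)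
Section of_coord.
Variable f : Z -> R.
Hypotheses (bf : uniformly_bounded f) (ef : extremal alpha f).

Let rho x y := alpha x y * expR (- f x - f y).

Let rho_le1 x y : rho x y <= 1.
Proof.
have [+ _] := ef => /(_ x y) H.
by rewrite /rho -opprD expRN ler_pdivrMr ?expR_gt0// mul1r.
Qed.

Let rho_antip x : exists y, rho x y = 1.
Proof.
have cn : {within setT, continuous (fun y => alpha x y * expR (- f y))}.
  apply: continuous_subspaceT => y; apply: cvgM.
    have := @alpha_continuous x y; rewrite (_ : alpha^~ x = alpha x)//.
    by apply/funext => z; exact: alpha_sym.
  apply: (@continuous_comp _ _ _ (fun x => - f x) (@expR R)).
    by apply: cvgN; exact: extremal_continuous.
  exact: continuous_expR.
have [|y _ H] := @compact_EVT_max _ _ _ setT _ (@apt_compact R Z) cn.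
  by exists x.
exists y; apply/eqP; rewrite eq_le rho_le1/=.
have a0 : 0 < alpha x y * expR (- f y).
  have [y1 a1] := alpha_antip x.
  apply: (@lt_le_trans _ _ (alpha x y1 * expR (- f y1))).
    by rewrite a1 mul1r expR_gt0.
  by apply: H; rewrite inE.
have : f x <= ln (alpha x y * expR (- f y)).
  have [_ ef'] := ef; apply: ef' => z.
  rewrite expRD lnK ?posrE// -ler_pdivrMr ?expR_gt0// -expRN.
  by apply: H; rewrite inE.
rewrite -ler_expR lnK ?posrE// => h.
by rewrite /rho expRD mulrCA expRN mulrC ler_pdivlMr ?expR_gt0// mul1r.
Qed.

Let rho_antipodal : antipodal rho.
Proof.
have cf := extremal_continuous bf ef.
apply: antipodal_of_le1 => //; split.
- have [c _ _ _] := sepa; move=> p; apply: cvgM; first exact: c.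
  apply: (@continuous_comp _ _ _ (fun p : Z * Z => - f p.1 - f p.2) (@expR R)).
    apply: cvgB; [apply: cvgN|].
      by apply: (@continuous_comp _ _ _ (@fst Z Z) f);
        [exact: cvg_fst|exact: cf].
    by apply: (@continuous_comp _ _ _ (@snd Z Z) f);
      [exact: cvg_snd|exact: cf].
  exact: continuous_expR.
- by move=> x y; rewrite /rho mulr_ge0 ?expR_ge0 ?alpha_ge0.
- by move=> x y; rewrite /rho alpha_sym addrC.
- move=> x y; rewrite /rho; split=> [/eqP|->]; last by rewrite alphaxx mul0r.
  by rewrite mulf_eq0 expR_eq0 orbF => /eqP/alpha_eq0.
Qed.

Let rho_equivalent : moebius_equivalent alpha rho.
Proof.
move=> x x' y y' u; rewrite /cross_ratio /rho.
rewrite (_ : _ / (alpha x y' * expR _ * _) =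
  (alpha x y * alpha x' y') * (expR (- f x - f y) * expR (- f x' - f y')) /
  ((alpha x y' * alpha x' y) * (expR (- f x - f y') * expR (- f x' - f y)))).
  rewrite -!expRD (_ : - f x - f y + _ = - f x - f y' + (- f x' - f y)); last ring.
  by rewrite -[RHS]mulf_div divff ?mulr1// expR_eq0.
by congr (_ / _); ring.
Qed.

Definition of_coord := MoebiusSpace rho_antipodal rho_equivalent.

Lemma of_coordK : mcoord of_coord = f.
Proof.
apply/funext => x; rewrite /mcoord.
rewrite (@derivativeE _ _ (apt_four Z) alpha _ (fun x => expR (- (2 * f x))) sepa).
  by rewrite expRK; field.
split.
- move=> y; apply: (@continuous_comp _ _ _ (fun x => - (2 * f x)) (@expR R)).
    apply: cvgN; apply: cvgM; first exact: cvg_cst.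
    exact: extremal_continuous.
  exact: continuous_expR.
- by move=> y; exact: expR_gt0.
- move=> y z; rewrite /= /rho exprMn mulrC [X in X * _ = _]expr2 -!expRD.
  by congr (expR _ * _); ring.
Qed.

End of_coord.

Lemma derivative_mcoord p q x :
  derivative p q x = expR (2 * (mcoord p x - mcoord q x)).
Proof.
rewrite (@derivativeE _ _ (apt_four Z) p _
  (fun x => expR (2 * (mcoord p x - mcoord q x))) (sepm p))//.
split.
- move=> y; apply: (@continuous_comp _ _ _ (fun x => 2 * (mcoord p x - mcoord q x)) (@expR R)).
    apply: cvgM; first exact: cvg_cst.
    by apply: cvgB; exact: mcoord_continuous.
  exact: continuous_expR.
- by move=> y; exact: expR_gt0.
- move=> y z; rewrite !mcoordE !exprMn [RHS]mulrCA; congr (_ * _).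
  by rewrite !expr2 -!expRD; congr expR; ring.
Qed.

Let dist_set p q := [set `|ln (derivative p q x)| | x in [set: Z]].

Let dist_setE p q x : `|ln (derivative p q x)| = 2 * `|mcoord p x - mcoord q x|.
Proof. by rewrite derivative_mcoord expRK normrM gtr0_norm. Qed.

Let max_coord p q : exists x, forall y,
  `|mcoord p y - mcoord q y| <= `|mcoord p x - mcoord q x|.
Proof.
have [x0 _] := antipodalSpace_inh.
have cn : {within setT, continuous (fun x => `|mcoord p x - mcoord q x|)}.
  apply: continuous_subspaceT => x; apply: cvg_norm.
  by apply: cvgB; exact: mcoord_continuous.
have [|x _ H] := @compact_EVT_max _ _ _ setT _ (@apt_compact R Z) cn.
  by exists x0.
by exists x => y; apply: H; rewrite inE.
Qed.

Lemma mdist_mcoord_attained p q :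
  exists x, mdist p q = 2 * `|mcoord p x - mcoord q x|.
Proof.
have [x H] := max_coord p q; exists x.
have ub : ubound (dist_set p q) (2 * `|mcoord p x - mcoord q x|).
  by move=> _ [y _ <-]; rewrite dist_setE ler_pM2l.
rewrite mdist_moebiusE /moebius_dist; apply/eqP; rewrite eq_le; apply/andP; split.
  by apply: ge_sup => //; exists `|ln (derivative p q x)|; exists x.
apply: ub_le_sup; first by exists (2 * `|mcoord p x - mcoord q x|).
by exists x => //; rewrite dist_setE.
Qed.

Lemma mdist_mcoord_ge p q x : 2 * `|mcoord p x - mcoord q x| <= mdist p q.
Proof.
have [y H] := max_coord p q.
rewrite mdist_moebiusE /moebius_dist -dist_setE; apply: ub_le_sup; last by exists x.
by exists (2 * `|mcoord p y - mcoord q y|) => _ [z _ <-]; rewrite dist_setE ler_pM2l.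
Qed.

Lemma mdist_mcoord_le p q c :
  (forall x, `|mcoord p x - mcoord q x| <= c) -> mdist p q <= 2 * c.
Proof. by move=> H; have [x ->] := mdist_mcoord_attained p q; rewrite ler_pM2l. Qed.

Lemma mcoord_le p q x : mcoord p x <= mcoord q x + mdist p q / 2.
Proof. by have := mdist_mcoord_ge p q x; have := ler_norm (mcoord p x - mcoord q x); lra. Qed.

Lemma alpha_le_mcoord e x y : alpha x y <= expR (mcoord e x + mcoord e y).
Proof. by have [+ _] := mcoord_extremal e; apply. Qed.

(** The uniform norm of a difference of coordinates is attained with both signs:
    at a point that is antipodal, for the one function, to a point where the
    difference is maximal, it is minimal. *)
Lemma mcoord_min_attained p q : exists xi, mcoord q xi = mcoord p xi - mdist p q / 2.
Proof.
have [x] := mdist_mcoord_attained p q.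
have [h|h] := leP 0 (mcoord p x - mcoord q x).
  by rewrite ger0_norm// => E; exists x; rewrite E; field.
rewrite ltr0_norm// => E; have [y xy] := mcoord_antip q x; exists y.
have := alpha_le_mcoord p x y; rewrite xy ler_expR => h1.
have := mcoord_le p q y; lra.
Qed.

Lemma mcoord_inj p q : mcoord p = mcoord q -> p = q.
Proof.
move=> E; apply: mdist_positivity; apply/eqP; rewrite eq_le mdist_ge0 andbT.
have := @mdist_mcoord_le p q 0; rewrite mulr0; apply => x.
by rewrite E subrr normr0.
Qed.

Lemma alpha_le_mdist p q x y :
  alpha x y <= expR (mcoord p x + mcoord q y + mdist p q / 2).
Proof.
apply: le_trans (alpha_le_mcoord p x y) _; rewrite ler_expR.
by have := mcoord_le p q y; lra.
Qed.

(** With [alpha_le_mdist]: half the distance is the maximum of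
    ln (alpha x y) - mcoord p x - mcoord q y. *)
Lemma alpha_mdist_attained p q :
  exists x y, alpha x y = expR (mcoord p x + mcoord q y + mdist p q / 2).
Proof.
have [xi E] := mcoord_min_attained p q; have [y xy] := mcoord_antip p xi.
rewrite metric_sym in E; have [yi E'] := mcoord_min_attained q p.
have [z zy] := mcoord_antip q yi.
exists yi, z; rewrite zy metric_sym; congr expR.
by rewrite E'; ring.
Qed.

End moebius_coordinates.


(** * Properness and geodesics *)

Lemma ultra_cvg_compact (T : Type) (U : topologicalType) (F : set_system T)
    (g : T -> U) (K : set U) :
  UltraFilter F -> compact K -> F (g @^-1` K) ->
  exists2 l, K l & g @ F --> l.
Proof.
move=> FU cK FK; have [l [Kl cl]] := cK (g @ F) _ FK.
exists l => // B Bl; have [//|FB] := in_ultra_setVsetC (g @^-1` B) FU.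
by have [z [] ] := cl (~` B) B FB Bl.
Qed.

(** A 1-Lipschitz path whose length is the distance of its endpoints wastes
    nothing on any piece. *)
Lemma geodesic_of_lip (R : realType) (X : metricType R) (L : R) (c : R -> X) :
  0 <= L -> mdist (c 0) (c L) = L ->
  (forall s t, 0 <= s -> s <= t -> t <= L -> mdist (c s) (c t) <= t - s) ->
  geodesic_on `[0, L] c.
Proof.
move=> L0 dL lip s t; rewrite /= !in_itv/= => /andP[s0 sL] /andP[t0 tL].
wlog st : s t s0 sL t0 tL / s <= t.
  move=> wl; have [/wl|/ltW/wl] := leP s t; first exact.
  by rewrite metric_sym distrC; exact.
rewrite distrC ger0_norm ?subr_ge0//; apply/eqP; rewrite eq_le lip//=.
have := metric_triangle (c 0) (c s) (c L).
have := metric_triangle (c s) (c t) (c L).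
have := lip 0 s (lexx _) s0 sL; have := lip t L t0 tL (lexx _).
rewrite dL; lra.
Qed.

Section moebius_geometry.
Context {R : realType} {Z : antipodalSpace R}.
Implicit Types (e p q : moebius_space Z) (f : Z -> R).
Implicit Types (x y z xi eta : Z).

Local Notation alpha := (@apt_fun R Z).

Lemma extremal_approx f :
  (forall r : R, 0 < r -> exists e, forall x, `|mcoord e x - f x| <= r) ->
  extremal alpha f.
Proof.
move=> H; split=> [x y|x c h].
  have [a0|a0] := leP (alpha x y) 0; first by apply: le_trans a0 (expR_ge0 _).
  rewrite -(@lnK _ (alpha x y)) ?posrE// ler_expR.
  apply/ler_addgt0Pr => r r0; have [e ef] := H _ (divr_gt0 r0 (ltr0n R 2)).
  have := alpha_le_mcoord e x y; rewrite -{1}(@lnK _ (alpha x y)) ?posrE//.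
  by rewrite ler_expR; have := ef x; have := ef y; rewrite !ler_norml; lra.
apply/ler_addgt0Pr => r r0; have [e ef] := H _ (divr_gt0 r0 (ltr0n R 2)).
have [_ /(_ x (c + r / 2))] := mcoord_extremal e.
have := ef x; rewrite ler_norml => efx; suff h' y : alpha x y <= expR (c + r / 2 + mcoord e y).
  by move=> /(_ h'); lra.
apply: le_trans (h y) _; rewrite ler_expR.
by have := ef y; rewrite ler_norml; lra.
Qed.

(** Along an ultrafilter on a ball the coordinates converge pointwise; by
    [extremal_modulus] they do so uniformly, and the limit is extremal. *)
Lemma moebius_proper : proper_space (moebius_space Z).
Proof.
move=> p r; rewrite compact_ultra => F FU FA.
have [C pC] := mcoord_bounded p; pose D := C + r / 2.
have AD e x : mdist p e <= r -> `|mcoord e x| <= D.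
  move=> per; have := mcoord_le p e x; have := mcoord_le e p x; rewrite metric_sym.
  by have := pC x; rewrite !ler_norml /D; lra.
have lims x : exists l, `|l| <= D /\ (fun e => mcoord e x) @ F --> l.
  have [|l] := @ultra_cvg_compact _ _ F (fun e => mcoord e x) _ FU
    (@segment_compact R (- D) D).
    by apply: filterS FA => e /= /(AD e x); rewrite ler_norml in_itv/=.
  by rewrite /= in_itv/= -ler_norml => lD cl; exists l.
have [f fP] := choice lims.
have fD x : `|f x| <= D by have [] := fP x.
have bf : uniformly_bounded f by exists D.
have fmod x x' s : (forall y, `|alpha x y - alpha x' y| <= s) ->
    f x <= f x' + s * expR (2 * D).
  move=> xs; rewrite leNgt; apply/negP => lt.
  pose m := (f x - f x' - s * expR (2 * D)) / 2.
  have m0 : 0 < m by rewrite /m divr_gt0//; lra.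
  have [_ /cvgrPdist_lt /(_ _ m0) h1] := fP x.
  have [_ /cvgrPdist_lt /(_ _ m0) h2] := fP x'.
  have [e [[e1 e2] e3]] := @filter_ex _ F _ _ (filterI (filterI h1 h2) FA).
  have := extremal_modulus (AD e ^~ e3) (mcoord_extremal e) xs.
  by move: e1 e2; rewrite /= !ltr_norml /m; lra.
have unif s : 0 < s -> \forall e \near F, forall x, `|mcoord e x - f x| <= s.
  move=> s0; pose s' := s / 3 * expR (- (2 * D)).
  have s'0 : 0 < s' by rewrite mulr_gt0 ?expR_gt0//; lra.
  have s'E : s' * expR (2 * D) = s / 3.
    by rewrite -mulrA -expRD addNr expR0 mulr1.
  have s3 : 0 < s / 3 by lra.
  have H := (compact_near_coveringP _).1 (@apt_compact R Z) _ F
    (fun e x => mdist p e <= r -> `|mcoord e x - f x| <= s) _.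
  have : \near F, setT `<=` (fun x => mdist p F <= r -> `|mcoord F x - f x| <= s).
    apply: H => x _.
    have [_ /cvgrPdist_lt /(_ _ s3) h1] := fP x.
    exists ([set x' | forall y, `|alpha x y - alpha x' y| <= s'],
      [set e | `|f x - mcoord e x| < s / 3]).
      by split => //=; exact: alpha_unif_near.
    move=> [x' e] /= [xx' ex] per.
    have xx'C y : `|alpha x' y - alpha x y| <= s' by rewrite distrC.
    have := extremal_modulus (AD e ^~ per) (mcoord_extremal e) xx'.
    have := extremal_modulus (AD e ^~ per) (mcoord_extremal e) xx'C.
    have := fmod _ _ _ xx'; have := fmod _ _ _ xx'C.
    rewrite s'E; move: ex; rewrite ltr_norml ler_norml; lra.
  move=> h; near=> e => x; have : mdist p e <= r by near: e.
  by move: x; near: e; apply: filterS h => e h x; apply: h.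
have ef : extremal alpha f.
  apply: extremal_approx => s s0; have [e He] := @filter_ex _ F _ _ (unif s s0).
  by exists e.
pose e0 := of_coord bf ef; have e0f : mcoord e0 = f by exact: of_coordK.
exists e0; split; last first.
  apply/metricType_numDomainType.fcvgrPdist_lt => s s0; have s3 : 0 < s / 3 by lra.
  apply: filterS (unif _ s3) => e He.
  apply: (@le_lt_trans _ _ (2 * (s / 3))); last by lra.
  by apply: mdist_mcoord_le => x; rewrite e0f distrC.
rewrite /=; have [x ->] := mdist_mcoord_attained p e0; rewrite e0f.
rewrite leNgt; apply/negP => lt.
have m0 : 0 < (2 * `|mcoord p x - f x| - r) / 2 by lra.
have [_ /cvgrPdist_lt /(_ _ m0) h1] := fP x.
have [e [e1 e2]] := @filter_ex _ F _ _ (filterI h1 FA).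
have := mdist_mcoord_ge p e x; have := ler_normD (mcoord p x - mcoord e x) (mcoord e x - f x).
rewrite addrA subrK; rewrite distrC in e1; move: e1 e2 => /=; lra.
Unshelve. all: by end_near. Qed.

Definition retract_elt f (bf : uniformly_bounded f) (af : admissible alpha f) :
    moebius_space Z :=
  of_coord (retraction_bounded alpha_le1 alpha_sym alpha_antip bf af)
    (extremal_retraction alpha_le1 alpha_sym alpha_antip bf af).

Lemma mcoord_retract_elt f (bf : uniformly_bounded f) (af : admissible alpha f) :
  mcoord (retract_elt bf af) = retraction alpha f.
Proof. exact: of_coordK. Qed.

Lemma retract_elt_le f (bf : uniformly_bounded f) (af : admissible alpha f) x :
  mcoord (retract_elt bf af) x <= f x.
Proof.
by rewrite mcoord_retract_elt; apply: retraction_le;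
  [exact: alpha_le1|exact: alpha_sym|exact: alpha_antip|..].
Qed.

Lemma retract_elt_id f (bf : uniformly_bounded f) (af : admissible alpha f) p :
  f = mcoord p -> retract_elt bf af = p.
Proof.
move=> fp; apply: mcoord_inj; rewrite mcoord_retract_elt retraction_id//.
- exact: alpha_le1.
- exact: alpha_sym.
- exact: alpha_antip.
- by rewrite fp; exact: mcoord_extremal.
Qed.

Lemma retract_elt_lip f g (bf : uniformly_bounded f) (af : admissible alpha f)
    (bg : uniformly_bounded g) (ag : admissible alpha g) c :
  (forall x, `|f x - g x| <= c) ->
  mdist (retract_elt bf af) (retract_elt bg ag) <= 2 * c.
Proof.
move=> fg; apply: mdist_mcoord_le => x; rewrite !mcoord_retract_elt.
by apply: retraction_lip;
  [exact: alpha_le1|exact: alpha_sym|exact: alpha_antip|..].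
Qed.

(** Admissible functions form a convex set, so the straight segment between two
    coordinates can be retracted. *)
Lemma moebius_geodesic : geodesic_space (moebius_space Z).
Proof.
move=> p q; set L := mdist p q.
have L0 : 0 <= L by exact: mdist_ge0.
(* Clamped, so that the path is admissible for every real parameter; when
   L = 0 the division by zero makes it constant. *)
pose th (t : R) := Num.max 0 (Num.min 1 (t / L)).
have th01 t : 0 <= th t <= 1.
  by rewrite /th le_max lexx/= ge_max ler01/= ge_min lexx.
have thL t : 0 <= t <= L -> th t * L = t.
  move=> /andP[t0 tL]; have [L00|Ln0] := eqVneq L 0.
    by rewrite L00 mulr0; apply/eqP; rewrite eq_le t0 -L00 tL.
  have Lp : 0 < L by rewrite lt_neqAle eq_sym Ln0.
  rewrite /th min_r ?ler_pdivrMr ?mul1r// max_r ?divfK//.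
  by rewrite divr_ge0.
pose f t x := (1 - th t) * mcoord p x + th t * mcoord q x.
have bf t : uniformly_bounded (f t).
  have [C pC] := mcoord_bounded p; have [C' qC] := mcoord_bounded q.
  exists (C + C') => x; apply: le_trans (ler_normD _ _) _.
  have /andP[t0 t1] := th01 t.
  rewrite (normrM (1 - _)) (normrM (th t)) (ger0_norm t0) (ger0_norm (etrans (subr_ge0 _ _) t1)).
  have := mulr_ge0 t0 (normr_ge0 (mcoord p x)).
  have := mulr_ge0 (etrans (subr_ge0 _ _) t1) (normr_ge0 (mcoord q x)).
  by have := pC x; have := qC x; lra.
have af t : admissible alpha (f t).
  apply: admissible_convex => //.
    by have [] := mcoord_extremal p.
  by have [] := mcoord_extremal q.
exists L, (fun t => retract_elt (bf t) (af t)).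
have c0 : retract_elt (bf 0) (af 0) = p.
  apply: retract_elt_id; apply/funext => x; rewrite /f.
  have -> : th 0 = 0.
    by rewrite /th mul0r min_r ?ler01// maxxx.
  by rewrite subr0 mul1r mul0r addr0.
have cL : retract_elt (bf L) (af L) = q.
  have [L00|Ln0] := eqVneq L 0; last first.
    apply: retract_elt_id; apply/funext => x; rewrite /f.
    have -> : th L = 1 by rewrite /th divff// minxx max_r.
    by rewrite subrr mul0r mul1r add0r.
  by rewrite L00 c0; apply: mdist_positivity.
split => //; apply: geodesic_of_lip => //; first by rewrite c0 cL.
move=> s t s0 st tL; rewrite (_ : t - s = 2 * ((t - s) / 2)); last by field.
apply: retract_elt_lip => x; rewrite /f.
have sE := thL s (ltac:(lra)); have tE := thL t (ltac:(lra)).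
have -> : (1 - th s) * mcoord p x + th s * mcoord q x -
  ((1 - th t) * mcoord p x + th t * mcoord q x) =
  (th t - th s) * (mcoord p x - mcoord q x) by ring.
have := mdist_mcoord_ge p q x; rewrite -/L => pq.
have ts : 0 <= (th t - th s) * L by rewrite mulrBl sE tE; lra.
have [L00|Ln0] := eqVneq L 0.
  have -> : mcoord p x - mcoord q x = 0.
    by apply/normr0_eq0; have := normr_ge0 (mcoord p x - mcoord q x); lra.
  by rewrite mulr0 normr0; lra.
have Lp : 0 < L by rewrite lt_neqAle eq_sym Ln0.
rewrite pmulr_lge0// in ts; rewrite normrM (ger0_norm ts).
have -> : (t - s) / 2 = (th t - th s) * (L / 2) by rewrite mulrA (mulrBl L) tE sE.
by apply: ler_wpM2l => //; lra.
Qed.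

End moebius_geometry.

(** * Rays, geodesic completeness and hyperbolicity *)

Section moebius_rays.
Context {R : realType} {Z : antipodalSpace R}.
Implicit Types (e p q : moebius_space Z) (f : Z -> R).
Implicit Types (x y z xi eta : Z).

Local Notation alpha := (@apt_fun R Z).

Hypothesis qmZ : quasi_metric Z.

Lemma quasi_metric_moebius p : exists2 K : R, 1 <= K & forall x y z,
  p x y <= K * Num.max (p x z) (p z y).
Proof.
have [K K1 aK] := qmZ; have [C pC] := mcoord_bounded p.
have C0 : 0 <= C by have [x _] := @antipodalSpace_inh R Z; apply: le_trans (pC x).
have K0 : 0 <= K by exact: le_trans K1.
have H x y : p x y <= alpha x y * expR (2 * C) /\ alpha x y <= p x y * expR (2 * C).
  rewrite mcoordE -mulrA -expRD.
  have := pC x; have := pC y; rewrite !ler_norml => hy hx.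
  split; first by rewrite ler_wpM2l ?alpha_ge0// ler_expR; lra.
  by rewrite ler_peMr ?alpha_ge0// -[leLHS]expR0 ler_expR; lra.
have E0 := expR_ge0 (2 * C).
exists (K * (expR (2 * C) * expR (2 * C))).
  rewrite -expRD -[leLHS]mulr1 ler_pM//.
  by rewrite -[leLHS]expR0 ler_expR; lra.
move=> x y z; have [h _] := H x y; apply: le_trans h _.
rewrite (_ : _ * Num.max _ _ =
  K * (expR (2 * C) * Num.max (p x z) (p z y)) * expR (2 * C)); last by ring.
apply: ler_wpM2r => //; apply: le_trans (aK x y z) _; apply: ler_wpM2l => //.
have [_ h1] := H x z; have [_ h2] := H z y.
rewrite maxr_pMr// ge_max !le_max ![expR _ * _]mulrC h1 h2 orbT.
by [].
Qed.

(** What the change of the coordinate at x after time 2 s would be along a ray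
    from rho towards xi if the space were a tree, with u = min(1, K rho(x, xi)).
    The formula is max(-s, s + ln u), read as -s at u = 0. *)
Definition ray_profile (s u : R) : R :=
  if u == 0 then - s else Num.max (- s) (s + ln u).

Lemma ray_profile_ge s u : - s <= ray_profile s u.
Proof. by rewrite /ray_profile; case: ifP => // _; rewrite le_max lexx. Qed.

Lemma ray_profile_ge_ln s u : 0 < u -> s + ln u <= ray_profile s u.
Proof. by move=> u0; rewrite /ray_profile gt_eqF// le_max lexx orbT. Qed.

Lemma ray_profile_le s u : 0 <= s -> u <= 1 -> ray_profile s u <= s.
Proof.
move=> s0 u1; rewrite /ray_profile; case: ifP => _; first lra.
by rewrite ge_max; have := ln_le0 u1; lra.
Qed.

Lemma ray_profile_lip s t u : s <= t ->
  `|ray_profile s u - ray_profile t u| <= t - s.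
Proof.
move=> st; rewrite /ray_profile; case: ifP => _.
  by rewrite opprK addrC ger0_norm ?subr_ge0.
by rewrite ler_norml; case: (leP (- s)); case: (leP (- t)); lra.
Qed.

(** Admissibility of the profile is where the quasi-metric inequality enters: it
    gives rho(x, y) <= max(u x, u y), and for the larger of the two the bound
    s + ln u applies while the other is at least -s.  The retraction can only
    lower the profile, and the Lipschitz bound forbids lowering it at xi. *)
Lemma exists_ray p xi : exists c : R -> moebius_space Z,
  [/\ geodesic_ray c, c 0 = p &
      forall t, 0 <= t -> mcoord (c t) xi = mcoord p xi - t / 2].
Proof.
have [K K1 pK] := quasi_metric_moebius p.
have K0 : 0 <= K by exact: le_trans K1.
have [[_ p0 psym pxx] _ _] := ms_antipodal p.
pose u x := Num.min 1 (K * p x xi).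
have u0 x : 0 <= u x by rewrite /u le_min ler01 mulr_ge0.
have u1 x : u x <= 1 by rewrite /u ge_min lexx.
pose sg (t : R) := Num.max 0 (t / 2).
have sg0 t : 0 <= sg t by rewrite /sg le_max lexx.
have sgE t : 0 <= t -> sg t = t / 2 by move=> t0; rewrite /sg max_r//; lra.
pose f t x := mcoord p x + ray_profile (sg t) (u x).
have bf t : uniformly_bounded (f t).
  have [C pC] := mcoord_bounded p; exists (C + sg t) => x.
  apply: le_trans (ler_normD _ _) _; apply: lerD => //.
  by rewrite ler_norml ray_profile_ge ray_profile_le.
have pu x y : p x y <= Num.max (u x) (u y).
  have p1 : p x y <= 1 by exact: antipodal_le1 (ms_antipodal p).
  rewrite /u; have [h1|h1] := leP 1 (K * p x xi); first by rewrite le_max p1.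
  have [h2|h2] := leP 1 (K * p y xi); first by rewrite le_max p1 orbT.
  by apply: le_trans (pK x y xi) _; rewrite maxr_pMr// (psym xi y).
have af t : admissible alpha (f t).
  move=> x y.
  have -> : f t x + f t y = ray_profile (sg t) (u x) + ray_profile (sg t) (u y) +
    (mcoord p x + mcoord p y) by rewrite /f; ring.
  rewrite expRD -ler_pdivrMr ?expR_gt0// -expRN opprD -mcoordE.
  apply: le_trans (pu x y) _.
  have H a b : 0 <= a <= 1 -> 0 <= b <= 1 -> b <= a ->
      a <= expR (ray_profile (sg t) a + ray_profile (sg t) b).
    move=> /andP[a0 a1] _ ba; have [->|an0] := eqVneq a 0; first exact: expR_ge0.
    have ap : 0 < a by rewrite lt_neqAle eq_sym an0.
    rewrite -{1}(@lnK _ a) ?posrE// ler_expR.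
    by have := ray_profile_ge_ln (sg t) ap; have := ray_profile_ge (sg t) b; lra.
  have [h|h] := leP (u x) (u y).
    by rewrite addrC H// ?u0 ?u1.
  by rewrite H// ?u0 ?u1// ltW.
pose c t := retract_elt (bf t) (af t).
have c0 : c 0 = p.
  apply: retract_elt_id; apply/funext => x; rewrite /f sgE// mul0r /ray_profile.
  case: ifP => _; first by rewrite oppr0 addr0.
  by rewrite oppr0 add0r max_l ?addr0// ln_le0.
have lip s t : 0 <= s -> s <= t -> mdist (c s) (c t) <= t - s.
  move=> s0 st; rewrite (_ : t - s = 2 * (t / 2 - s / 2)); last by field.
  apply: retract_elt_lip => x; rewrite /f !sgE ?(le_trans s0 st)//.
  rewrite (_ : _ - (_ + _) = ray_profile (s / 2) (u x) - ray_profile (t / 2) (u x)); last ring.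
  by apply: ray_profile_lip; lra.
have cxi t : 0 <= t -> mcoord (c t) xi = mcoord p xi - t / 2.
  move=> t0; apply/eqP; rewrite eq_le; apply/andP; split.
    apply: le_trans (retract_elt_le _ _ _) _; rewrite /f.
    have -> : u xi = 0 by rewrite /u (pxx xi xi).2// mulr0 min_r ?ler01.
    by rewrite /ray_profile eqxx sgE.
  have := mcoord_le p (c t) xi; have := lip 0 t (lexx _) t0; rewrite c0; lra.
exists c; split=> // s t; rewrite /= !in_itv/= !andbT => s0 t0.
wlog st : s t s0 t0 / s <= t.
  move=> wl; have [/wl|/ltW/wl] := leP s t; first exact.
  by rewrite metric_sym distrC; exact.
rewrite distrC ger0_norm ?subr_ge0//; apply/eqP; rewrite eq_le lip//=.
by have := mcoord_le (c s) (c t) xi; rewrite !cxi//; lra.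
Qed.

(** The coordinate at xi certifies that the concatenation of the three pieces is
    geodesic: it has slope -1/2 throughout, while no path of unit speed can do
    better. *)
Lemma moebius_complete : geodesically_complete (moebius_space Z).
Proof.
move=> a b c ab gc; pose p := c a; pose q := c b.
have gE s t : a <= s -> s <= t -> t <= b -> mdist (c s) (c t) = t - s.
  move=> h1 h2 h3; rewrite gc/= ?in_itv/=.
  - by rewrite distrC ger0_norm ?subr_ge0.
  - by rewrite h1 (le_trans h2).
  - by rewrite h3 (le_trans h1).
have pq : mdist p q = b - a by rewrite gE.
have [xi qxi] := mcoord_min_attained p q; rewrite pq in qxi.
have [eta pxe] := mcoord_antip p xi.
have qeta : mcoord q eta = mcoord p eta + (b - a) / 2.
  have := alpha_le_mcoord q xi eta; rewrite pxe ler_expR.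
  have := mcoord_le q p eta; rewrite metric_sym pq.
  by move=> h1 h2; apply/eqP; rewrite eq_le; apply/andP; split; lra.
have [r1 [gr1 r10 r1eta]] := exists_ray p eta.
have [r2 [gr2 r20 r2xi]] := exists_ray q xi.
have gray r s t : geodesic_ray r -> 0 <= s -> 0 <= t ->
    mdist (r s : moebius_space Z) (r t) = `|s - t|.
  by move=> gr s0 t0; apply: gr; rewrite /= in_itv/= andbT.
have r1xi t : 0 <= t -> mcoord (r1 t) xi = mcoord p xi + t / 2.
  move=> t0; have := alpha_le_mcoord (r1 t) xi eta; rewrite pxe ler_expR r1eta//.
  have := mcoord_le (r1 t) p xi; rewrite -{2}r10 gray// subr0 ger0_norm//.
  by move=> h1 h2; apply/eqP; rewrite eq_le; apply/andP; split; lra.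
pose c' t := if t < a then r1 (a - t) else if t <= b then c t else r2 (t - b).
have c'1 t : t <= a -> c' t = r1 (a - t).
  rewrite /c' le_eqVlt => /predU1P[->|->//].
  by rewrite ltxx ab subrr r10.
have c'2 t : a <= t -> t <= b -> c' t = c t.
  by move=> h1 h2; rewrite /c' ltNge h1 h2.
have c'3 t : b <= t -> c' t = r2 (t - b).
  move=> bt; rewrite /c' ltNge (le_trans ab bt)/=.
  by case: ifP => // tb; rewrite (_ : t = b) ?subrr ?r20//; apply/eqP; rewrite eq_le tb.
have c'xi t : mcoord (c' t) xi = mcoord p xi - (t - a) / 2.
  have [ta|/ltW a_t] := leP t a; first by rewrite c'1// r1xi; lra.
  have [tb|/ltW bt] := leP t b; last by rewrite c'3// r2xi ?qxi; lra.
  rewrite c'2//; have := mcoord_le p (c t) xi; have := mcoord_le (c t) q xi.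
  rewrite qxi !gE//.
  by move=> h1 h2; apply/eqP; rewrite eq_le; apply/andP; split; lra.
have lip s t : s <= t -> mdist (c' s) (c' t) <= t - s.
  move=> st.
  have l1 s' t' : s' <= t' -> t' <= a -> mdist (c' s') (c' t') <= t' - s'.
    move=> h1 h2; rewrite !c'1 ?(le_trans h1)// gray ?subr_ge0 ?(le_trans h1)//.
    by rewrite ger0_norm; lra.
  have l2 s' t' : a <= s' -> s' <= t' -> t' <= b -> mdist (c' s') (c' t') <= t' - s'.
    move=> h1 h2 h3; have h4 := le_trans h1 h2; have h5 := le_trans h2 h3.
    by rewrite !c'2// gE.
  have l3 s' t' : b <= s' -> s' <= t' -> mdist (c' s') (c' t') <= t' - s'.
    move=> h1 h2; rewrite !c'3 ?(le_trans h1)// gray ?subr_ge0 ?(le_trans h1)//.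
    by rewrite distrC ger0_norm; lra.
  have l23 s' t' : a <= s' -> s' <= t' -> mdist (c' s') (c' t') <= t' - s'.
    move=> h1 h2; have [tb|/ltW bt] := leP t' b; first exact: l2.
    have [sb|/ltW bs] := leP s' b; last exact: l3.
    apply: le_trans (metric_triangle _ (c' b) _) _.
    by have := l2 _ _ h1 sb (lexx _); have := l3 _ _ (lexx _) bt; lra.
  have [sa|/ltW as'] := leP s a; last exact: l23.
  have [ta|/ltW a_t] := leP t a; first exact: l1.
  apply: le_trans (metric_triangle _ (c' a) _) _.
  by have := l1 _ _ sa (lexx _); have := l23 _ _ (lexx _) a_t; lra.
exists c'; last by move=> t /andP[? ?]; rewrite c'2.
move=> s t _ _; wlog st : s t / s <= t.
  move=> wl; have [/wl//|/ltW/wl] := leP s t.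
  by rewrite metric_sym distrC; exact.
rewrite distrC ger0_norm ?subr_ge0//; apply/eqP; rewrite eq_le lip//=.
by have := mcoord_le (c' s) (c' t) xi; rewrite !c'xi; lra.
Qed.

(** Apply the quasi-metric inequality to each factor on the left through the
    smallest of the four distances on the right. *)
Lemma alpha_four_point : exists2 K : R, 1 <= K & forall x y z v,
  alpha x y * alpha z v <=
    K * Num.max (alpha x z * alpha y v) (alpha x v * alpha y z).
Proof.
have [K K1 aK] := qmZ; have K0 : 0 <= K by exact: le_trans K1.
exists (K * K); first by rewrite -[leLHS]mulr1 ler_pM.
move=> x y z v.
have h1 := aK x y z; have h2 := aK x y v; have h3 := aK z v x; have h4 := aK z v y.
rewrite (alpha_sym z y) (alpha_sym v y) (alpha_sym z x) in h1 h2 h3 h4.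
have := alpha_ge0 x y; have := alpha_ge0 z v; move: h1 h2 h3 h4.
have := alpha_ge0 x z; have := alpha_ge0 y v.
have := alpha_ge0 x v; have := alpha_ge0 y z.
set A := alpha x y; set B := alpha z v; set a := alpha x z; set b := alpha y v.
set c := alpha x v; set d := alpha y z.
move=> d0 c0 b0 a0 h1 h2 h3 h4 B0 A0.
have key m n : A <= K * m -> B <= K * n -> A * B <= K * K * (m * n).
  move=> Am Bn; rewrite (_ : K * K * (m * n) = (K * m) * (K * n)); last by ring.
  exact: ler_pM.
have KK0 : 0 <= K * K by rewrite mulr_ge0.
have fin m : A * B <= K * K * m -> m <= Num.max (a * b) (c * d) ->
    A * B <= K * K * Num.max (a * b) (c * d).
  by move=> h h'; apply: le_trans h _; rewrite ler_wpM2l.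
have [ad|da] := leP a d; have [ac|ca] := leP a c.
- apply: (fin (d * c)); last by rewrite mulrC le_max lexx orbT.
  by apply: key; [move: h1|move: h3]; rewrite ?(max_r ad)// (max_r ac).
- have [cb|bc] := leP c b.
    apply: (fin (b * a)); last by rewrite mulrC le_max lexx.
    by apply: key; [move: h2|move: h3]; rewrite ?(max_r cb)// (max_l (ltW ca)).
  apply: (fin (c * d)); last by rewrite le_max lexx orbT.
  apply: key; [move: h2|move: h4]; rewrite ?(max_l (ltW bc))//.
  by rewrite max_l// ltW// (lt_trans bc)// (lt_le_trans ca).
- have [db|bd] := leP d b.
    apply: (fin (a * b)); last by rewrite le_max lexx.
    by apply: key; [move: h1|move: h4]; rewrite ?(max_l (ltW da))// (max_r db).
  apply: (fin (c * d)); last by rewrite le_max lexx orbT.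
  apply: key; [move: h2|move: h4]; rewrite ?(max_l (ltW bd))//.
  by rewrite max_l// ltW// (lt_trans bd)// (lt_le_trans da).
- have [cd|dc] := leP c d.
    have [cb|bc] := leP c b.
      apply: (fin (b * a)); last by rewrite mulrC le_max lexx.
      by apply: key; [move: h2|move: h3]; rewrite ?(max_r cb)// (max_l (ltW ca)).
    apply: (fin (c * d)); last by rewrite le_max lexx orbT.
    apply: key; [move: h2|move: h4]; rewrite ?(max_l (ltW bc))//.
    by rewrite max_l// ltW// (lt_le_trans bc).
  have [db|bd] := leP d b.
    apply: (fin (a * b)); last by rewrite le_max lexx.
    by apply: key; [move: h1|move: h4]; rewrite ?(max_l (ltW da))// (max_r db).
  apply: (fin (c * d)); last by rewrite le_max lexx orbT.
  apply: key; [move: h2|move: h4]; rewrite ?(max_l (ltW bd))//.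
  by rewrite max_l// ltW// (lt_trans bd).
Qed.

(** Evaluate the four-point inequality of [alpha] at points where the two
    distances on the left are attained. *)
Lemma moebius_hyperbolic : gromov_hyperbolic (moebius_space Z).
Proof.
have [K K1 aK] := alpha_four_point.
have K0 : 0 < K by exact: lt_le_trans K1.
have four p q (r s : moebius_space Z) : mdist p q + mdist r s <=
    Num.max (mdist p r + mdist q s) (mdist p s + mdist q r) + 2 * ln K.
  have [x [y xy]] := alpha_mdist_attained p q.
  have [z [v zv]] := alpha_mdist_attained r s.
  have [M [-> M1 M2]] : exists M : R,
      [/\ Num.max (mdist p r + mdist q s) (mdist p s + mdist q r) = M,
        mdist p r + mdist q s <= M & mdist p s + mdist q r <= M].
    exists (Num.max (mdist p r + mdist q s) (mdist p s + mdist q r)).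
    by split; rewrite ?le_max ?lexx ?orbT.
  set S := mcoord p x + mcoord q y + mcoord r z + mcoord s v.
  have Mle m n : m <= expR (S + n / 2) -> n <= M -> m <= expR (S + M / 2).
    move=> h nM; apply: le_trans h _.
    by rewrite ler_expR lerD2l ler_pM2r ?invr_gt0.
  have h : Num.max (alpha x z * alpha y v) (alpha x v * alpha y z) <=
      expR (S + M / 2).
    rewrite ge_max; apply/andP; split; [apply: Mle M1|apply: Mle M2].
      rewrite (_ : S + _ = (mcoord p x + mcoord r z + mdist p r / 2) +
        (mcoord q y + mcoord s v + mdist q s / 2)); last by rewrite /S; ring.
      by rewrite expRD ler_pM ?alpha_ge0// alpha_le_mdist.
    rewrite (_ : S + _ = (mcoord p x + mcoord s v + mdist p s / 2) +
      (mcoord q y + mcoord r z + mdist q r / 2)); last by rewrite /S; ring.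
    by rewrite expRD ler_pM ?alpha_ge0// alpha_le_mdist.
  have := le_trans (aK x y z v) (ler_wpM2l (ltW K0) h).
  rewrite xy zv -expRD -{1}(@lnK _ K) ?posrE// -expRD ler_expR /S.
  clear; move: (mcoord p x) (mcoord q y) (mcoord r z) (mcoord s v) (ln K).
  by move: (mdist p q) (mdist r s) => *; lra.
exists (ln K) => p x y z; rewrite /gromov_product.
have := four x z y p; rewrite (metric_sym x p) (metric_sym z p) (metric_sym z y).
rewrite (metric_sym y p).
set A := (X in Num.min X _); set B := (X in Num.min _ X).
have mA : Num.min A B <= A by rewrite ge_min lexx.
have mB : Num.min A B <= B by rewrite ge_min lexx orbT.
have [_|_] := leP (mdist x y + mdist p z) (mdist p x + mdist y z).
  by move=> h; move: mA mB; rewrite /A /B; lra.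
by move=> h; move: mA mB; rewrite /A /B; lra.
Qed.

End moebius_rays.

(** * Limits of geodesic rays in proper metric spaces *)

Lemma exists_subsequence (P : nat -> nat -> Prop) :
  (forall k N, exists2 m, (N <= m)%N & P k m) ->
  exists2 sigma : nat -> nat, increasing_seq sigma & forall k, P k (sigma k).
Proof.
move=> h; have {}h (kN : nat * nat) : exists m, (kN.2 <= m)%N /\ P kN.1 m.
  by have [m ? ?] := h kN.1 kN.2; exists m.
have [g gP] := choice h.
pose s := fix s k := if k is k'.+1 then g (k, (s k').+1) else g (0, 0)%N.
exists s; first by apply/increasing_seqP => n /=; have [] := gP (n.+1, (s n).+1).
by case=> [|k]; [exact: (gP (0, 0)%N).2|exact: (gP (k.+1, (s k).+1)).2].
Qed.

Lemma limits_eq (T : Type) (U : topologicalType) (F : set_system T) (f g : T -> U)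
    (x y : U) : hausdorff_space U -> ProperFilter F -> f =1 g ->
  f @ F --> x -> g @ F --> y -> x = y.
Proof.
by move=> hU FF /funext-> fx gy; exact: (@cvg_unique _ hU (g @ F) _ _ _ fx gy).
Qed.
Arguments limits_eq {T U F f g x y}.

Section metric_limits.
Context {R : realType} {X : metricType R}.
Implicit Types (x y p : X) (c : R -> X) (r s t : R).

Lemma mdist_cvg (T : Type) (F : set_system T) (f g : T -> X) x y : Filter F ->
  f @ F --> x -> g @ F --> y -> mdist (f n) (g n) @[n --> F] --> mdist x y.
Proof.
move=> FF fx gy; apply/cvgrPdist_le => e e0.
have e2 : 0 < e / 2 by rewrite divr_gt0.
have h : \forall n \near F, mdist x (f n) < e / 2.
  exact: metricType_numDomainType.cvgr_dist_lt.
have h' : \forall n \near F, mdist y (g n) < e / 2.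
  exact: metricType_numDomainType.cvgr_dist_lt.
apply: filterS (filterI h h') => n [/= h1 h2].
have := metric_triangle x (f n) y; have := metric_triangle (f n) (g n) y.
have := metric_triangle (f n) x (g n); have := metric_triangle x y (g n).
by rewrite (metric_sym (f n) x) (metric_sym (g n) y) ler_norml; lra.
Qed.

Lemma min_cvg (T : Type) (F : set_system T) (f : T -> R) s (a : R) : Filter F ->
  f @ F --> a -> Num.min s (f n) @[n --> F] --> Num.min s a.
Proof.
move=> FF /cvgrPdist_le fa; apply/cvgrPdist_le => e /fa; apply: filterS => n.
by rewrite !ler_norml; case: (leP s a); case: (leP s (f n)); lra.
Qed.

(** Generalized rays are the solutions of this system of equations in distances,
    which passes to pointwise limits; the length at which the ray becomes
    constant, possibly infinite, need not be mentioned. *)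
Definition truncated_ray c : Prop := forall s t, 0 <= s -> s <= t ->
  mdist (c 0) (c s) = Num.min s (mdist (c 0) (c t)) /\
  mdist (c s) (c t) = mdist (c 0) (c t) - mdist (c 0) (c s).

Lemma geodesic_rayE c : geodesic_ray c ->
  forall s t, 0 <= s -> 0 <= t -> mdist (c s) (c t) = `|s - t|.
Proof. by move=> gc s t s0 t0; apply: gc; rewrite /= in_itv/= andbT. Qed.

Lemma geodesic_ray0 c : geodesic_ray c ->
  forall t, 0 <= t -> mdist (c 0) (c t) = t.
Proof. by move=> gc t t0; rewrite geodesic_rayE// sub0r normrN ger0_norm. Qed.

Lemma generalized_ray_truncated p z c : generalized_ray p z c -> truncated_ray c.
Proof.
move=> [cp]; case: z => [x [L [L0 gL cL]]|xi [gc _]] s t s0 st; last first.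
  have t0 := le_trans s0 st.
  rewrite !geodesic_ray0// min_l// geodesic_rayE// distrC ger0_norm ?subr_ge0//.
have g u v : 0 <= u -> u <= v -> v <= L -> mdist (c u) (c v) = v - u.
  move=> h1 h2 h3; rewrite gL/= ?in_itv/= ?h1 ?h3 ?(le_trans h2)// ?(le_trans h1)//.
  by rewrite distrC ger0_norm ?subr_ge0.
have t0 := le_trans s0 st.
have cLL u : L <= u -> c u = c L by move=> Lu; rewrite !cL.
have [tL|/ltW Lt] := leP t L.
  have sL := le_trans st tL.
  by rewrite !g// !subr0 min_l.
rewrite (cLL t Lt) (g 0 L)// subr0; have [sL|/ltW Ls] := leP s L.
  by rewrite !g// subr0.
by rewrite (cLL s Ls) mdistxx g// subr0 subrr.
Qed.

Lemma truncated_rayP c : truncated_ray c ->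
  (exists x, generalized_ray (c 0) (Inner x) c) \/ geodesic_ray c.
Proof.
move=> tc; have [H|] := pselect (forall t, 0 <= t -> mdist (c 0) (c t) = t).
  right=> s t; rewrite /= !in_itv/= !andbT => s0 t0.
  wlog st : s t s0 t0 / s <= t.
    move=> wl; have [/wl|/ltW/wl] := leP s t; first exact.
    by rewrite metric_sym distrC; exact.
  by have [_ ->] := tc s t s0 st; rewrite !H// distrC ger0_norm ?subr_ge0.
move=> /existsNP[s /not_implyP[s0 sn]]; left.
pose L := mdist (c 0) (c s); have L0 : 0 <= L by exact: mdist_ge0.
have Ls : L < s.
  rewrite lt_neqAle; apply/andP; split; first exact/eqP.
  by have [+ _] := tc s s s0 (lexx _) => /esym/min_idPr.
have mL t : s <= t -> mdist (c 0) (c t) = L.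
  move=> st; have [+ _] := tc s t s0 st; rewrite -/L => E.
  by move: Ls; rewrite E; case: (leP s (mdist (c 0) (c t))) => // _; rewrite ltxx.
have m t : 0 <= t -> t <= s -> mdist (c 0) (c t) = Num.min t L.
  by move=> t0 ts; have [-> _] := tc t s t0 ts.
have mLL : mdist (c 0) (c L) = L by rewrite m// ?minxx// ltW.
exists (c L); split => //; exists L; split => //.
- move=> u v; rewrite /= !in_itv/= => /andP[u0 uL] /andP[v0 vL].
  wlog uv : u v u0 uL v0 vL / u <= v.
    move=> wl; have [/wl|/ltW/wl] := leP u v; first exact.
    by rewrite metric_sym distrC; exact.
  have [_ ->] := tc u v u0 uv.
  rewrite !m ?(le_trans _ (ltW Ls))// !min_l// distrC ger0_norm ?subr_ge0//.
- move=> t Lt; apply/esym/mdist_positivity; have [_ ->] := tc L t L0 Lt.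
  rewrite mLL; have [ts|/ltW st] := leP t s; last by rewrite mL// subrr.
  by rewrite m ?(le_trans L0)// min_r// subrr.
Qed.

Lemma truncated_ray_le c t : truncated_ray c -> 0 <= t -> mdist (c 0) (c t) <= t.
Proof. by move=> tc t0; have [+ _] := tc t t t0 (lexx _) => /esym/min_idPr. Qed.

Lemma truncated_ray_lip c s t : truncated_ray c -> 0 <= s -> s <= t ->
  mdist (c s) (c t) <= t - s.
Proof.
move=> tc s0 st; have [h ->] := tc s t s0 st.
have := truncated_ray_le tc (le_trans s0 st); rewrite h.
by case: (leP s (mdist (c 0) (c t))); lra.
Qed.

Lemma truncated_ray_lim (T : Type) (F : set_system T) (f : T -> R -> X) c :
  ProperFilter F -> (forall n, truncated_ray (f n)) ->
  (forall t, 0 <= t -> f n t @[n --> F] --> c t) -> truncated_ray c.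
Proof.
move=> FF tf fc s t s0 st; have t0 := le_trans s0 st; split.
  apply: (limits_eq (@Rhausdorff R) FF _ (mdist_cvg _ (fc 0 (lexx _)) (fc s s0))
    (min_cvg (s := s) _ (mdist_cvg _ (fc 0 (lexx _)) (fc t t0)))) => n /=.
  by have [] := tf n s t s0 st.
apply: (limits_eq (@Rhausdorff R) FF _ (mdist_cvg _ (fc s s0) (fc t t0))
  (cvgB (mdist_cvg _ (fc 0 (lexx _)) (fc t t0))
    (mdist_cvg _ (fc 0 (lexx _)) (fc s s0)))) => n /=.
by have [] := tf n s t s0 st.
Qed.

(** An ultrafilter replaces the diagonal extraction: it converges at all times
    simultaneously. *)
Lemma proper_ultralimit (T : Type) (F : set_system T) (f : T -> R -> X) p
    (C : R -> R) :
  proper_space X -> UltraFilter F -> (forall n t, mdist p (f n t) <= C t) ->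
  exists c, forall t, f n t @[n --> F] --> c t.
Proof.
move=> pX UF fC.
have H t : exists l : X, f n t @[n --> F] --> l.
  have [|l _ ?] := @ultra_cvg_compact _ _ F (fun n => f n t) _ UF (pX p (C t)).
    by apply: filterS filterT => n _ /=; exact: fC.
  by exists l.
by have [c cP] := choice H; exists c.
Qed.

Lemma nat_ultrafilter : exists2 U : set_system nat, UltraFilter U & \oo `<=` U.
Proof. by have [U [? ?]] := @ultraFilterLemma nat \oo _; exists U. Qed.

Lemma uniform_cvg_near (f : nat -> R -> X) c (K : set R) :
  (forall e, 0 < e -> \forall n \near \oo, forall t, K t -> mdist (c t) (f n t) < e) ->
  {uniform K, f @ \oo --> c}.
Proof.
move=> H P /uniform_nbhs[E [+ EP]].
rewrite -entourage_ballE => -[e e0 eE].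
apply: filterS (H e e0) => n h; apply: EP => t Kt /=; apply: eE => /=.
by rewrite ballEmdist; exact: h.
Qed.

Lemma uniform_cvg_pointwise (f : nat -> R -> X) c (K : set R) t :
  {uniform K, f @ \oo --> c} -> K t -> f n t @[n --> \oo] --> c t.
Proof.
move=> H Kt; apply/metricType_numDomainType.cvgrPdist_lt => e e0.
apply: (H [set h | mdist (c t) (h t) < e]).
apply/uniform_nbhs; exists [set xy | ball xy.1 e xy.2]; split.
  by rewrite -entourage_ballE; exists e.
by move=> h /(_ t Kt) /=; rewrite ballEmdist.
Qed.

(** The limit along an ultrafilter is approached, for each k, on the grid of step
    1/(k+1) in [0, k+1]; the Lipschitz bound fills the gaps. *)
Lemma arzela_ascoli_rays p (f : nat -> R -> X) : proper_space X ->
  (forall n, truncated_ray (f n)) -> (forall n, f n 0 = p) ->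
  exists2 psi : nat -> nat, increasing_seq psi &
  exists c, [/\ truncated_ray c, c 0 = p &
    forall K : set R, compact K -> K `<=` `[0, +oo[ ->
      {uniform K, (fun n => f (psi n)) @ \oo --> c}].
Proof.
move=> pX tf f0.
have [U UU ooU] := nat_ultrafilter.
have [|c cP] := @proper_ultralimit nat U (fun n t => f n (Num.max 0 t)) p
    (fun t => Num.max 0 t) pX UU.
  move=> n t; rewrite -(f0 n); apply: truncated_ray_le => //.
  by rewrite le_max lexx.
have {}cP t : 0 <= t -> f n t @[n --> U] --> c t.
  by move=> t0; have := cP t; rewrite max_r.
have tc : truncated_ray c by exact: (truncated_ray_lim _ tf cP).
have c0 : c 0 = p.
  have := cP 0 (lexx _); rewrite (_ : (fun n => f n 0) = fun=> p); last first.
    by apply/funext.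
  by move=> h; apply: (cvg_unique (@metric_hausdorff _ X) h); exact: cvg_cst.
pose g (k : nat) : R := k.+1%:R^-1.
have g0 k : 0 < g k by rewrite invr_gt0.
have [psi ipsi psiP] : exists2 psi : nat -> nat, increasing_seq psi &
    forall k (j : 'I_(k.+1 * k.+1)),
      mdist (c (j%:R * g k)) (f (psi k) (j%:R * g k)) < g k.
  apply: (@exists_subsequence (fun k m => forall j : 'I_(k.+1 * k.+1),
    mdist (c (j%:R * g k)) (f m (j%:R * g k)) < g k)) => k N.
  have : \forall n \near U, forall j : 'I_(k.+1 * k.+1),
      mdist (c (j%:R * g k)) (f n (j%:R * g k)) < g k.
    apply: filter_forall => j.
    have t0 : 0 <= (j : nat)%:R * g k by rewrite mulr_ge0// ltW.
    exact: (metricType_numDomainType.cvgr_dist_lt (cP _ t0)).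
  move=> h; have hN : U [set n | (N <= n)%N] by apply: ooU; exists N.
  have [n [nN nP]] := @filter_ex _ U _ _ (filterI hN h).
  by exists n.
exists psi => //; exists c; split => // K cK K0.
have [M KM] : exists M : R, forall t, K t -> 0 <= t <= M.
  have /= [M [_ MK]] := compact_bounded cK; exists (M + 1) => t Kt.
  have := K0 t Kt; rewrite /= in_itv/= andbT => t0; rewrite t0/=.
  have := MK (M + 1) (ltac:(lra)) t Kt; rewrite /= ger0_norm//.
apply: uniform_cvg_near => e e0.
pose N := maxn (Num.truncn (3 / e)) (Num.truncn M).
exists N => // k /= Nk t /KM/andP[t0 tM].
have gk : 3 * g k < e.
  rewrite /g ltr_pdivrMr ?ltr0n// -ltr_pdivrMl// mulrC.
  apply: lt_le_trans (truncnS_gt _) _; rewrite ler_nat ltnS.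
  by apply: leq_trans Nk; rewrite leq_maxl.
have tk : t < k.+1%:R.
  apply: le_lt_trans tM _; apply: lt_le_trans (truncnS_gt _) _.
  by rewrite ler_nat ltnS; apply: leq_trans Nk; rewrite leq_maxr.
have gK : g k * k.+1%:R = 1 by rewrite mulVf.
have tk0 : 0 <= t * k.+1%:R by rewrite mulr_ge0.
pose j := Num.truncn (t * k.+1%:R).
have /andP[j1 j2] : j%:R <= t * k.+1%:R < j.+1%:R by exact: truncn_itv.
have jk : (j < k.+1 * k.+1)%N.
  rewrite -(ltr_nat R) natrM; apply: le_lt_trans j1 _.
  by rewrite ltr_pM2r.
have s1 : j%:R * g k <= t.
  by rewrite -(ler_pM2r (ltr0Sn R k)) -mulrA gK mulr1.
have s2 : t <= j%:R * g k + g k.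
  rewrite -(ler_pM2r (ltr0Sn R k)) mulrDl -mulrA gK mulr1.
  by apply: ltW; rewrite natr1.
have s0 : 0 <= j%:R * g k by rewrite mulr_ge0// ltW.
have := psiP k (Ordinal jk) => /= h.
have := metric_triangle (c t) (c (j%:R * g k)) (f (psi k) t).
have := metric_triangle (c (j%:R * g k)) (f (psi k) (j%:R * g k)) (f (psi k) t).
have := truncated_ray_lip tc s0 s1; rewrite (metric_sym _ (c t)).
have := truncated_ray_lip (tf (psi k)) s0 s1.
lra.
Qed.

End metric_limits.

(** * Boundary and cone topology *)

Section boundary_basics.
Context {R : realType} {X : metricType R}.
Implicit Types (x y p : X) (c : R -> X) (xi eta : boundary X).
Implicit Types (z : compactification X).

Lemma asymptotic_refl c : asymptotic c c.
Proof. by exists 0 => t _; rewrite mdistxx. Qed.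

Lemma asymptotic_sym c c' : asymptotic c c' -> asymptotic c' c.
Proof. by move=> [M H]; exists M => t /H; rewrite metric_sym. Qed.

Lemma asymptotic_trans c c' c'' :
  asymptotic c c' -> asymptotic c' c'' -> asymptotic c c''.
Proof.
move=> [M H] [M' H']; exists (M + M') => t t0.
apply: le_trans (metric_triangle _ (c' t) _) _.
by apply: lerD; [exact: H|exact: H'].
Qed.

Definition ray_boundary c (gc : geodesic_ray c) : boundary X :=
  Boundary (ex_intro2 _ _ c gc erefl).

Lemma mem_ray_boundary c (gc : geodesic_ray c) : bd_class (ray_boundary gc) c.
Proof. by split => //; exact: asymptotic_refl. Qed.

Lemma bd_exists xi : exists2 c, geodesic_ray c & bd_class xi c.
Proof.
case: xi => C [c gc CE]; exists c => //=; rewrite CE; split => //.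
exact: asymptotic_refl.
Qed.

Lemma bd_classE xi c c' : bd_class xi c ->
  bd_class xi c' <-> geodesic_ray c' /\ asymptotic c c'.
Proof.
case: xi => C [c0 gc CE] /=; rewrite CE => -[gc1 a1]; split=> -[gc2 a2].
  by split => //; apply: asymptotic_trans a2; exact: asymptotic_sym.
by split => //; apply: asymptotic_trans a2.
Qed.

Lemma bd_ray xi c : bd_class xi c -> geodesic_ray c.
Proof. by move=> h; have [] := (bd_classE c h).1 h. Qed.

Lemma bd_eq xi eta c : bd_class xi c -> bd_class eta c -> xi = eta.
Proof.
move=> h1 h2.
have E : bd_class xi = bd_class eta.
  by apply/seteqP; split=> c'; [move/(bd_classE c' h1)/(bd_classE c' h2)|
    move/(bd_classE c' h2)/(bd_classE c' h1)].
case: xi eta E {h1 h2} => [A pA] [B pB] /= AB; subst B.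
by congr Boundary; exact: Prop_irrelevance.
Qed.

Lemma generalized_ray_inner p x c t : generalized_ray p (Inner x) c ->
  0 <= t -> t <= mdist p x -> mdist p (c t) = t /\ mdist (c t) x = mdist p x - t.
Proof.
move=> [c0 [L [L0 gL cL]]].
have g u v : 0 <= u -> u <= v -> v <= L -> mdist (c u) (c v) = v - u.
  move=> h1 h2 h3; rewrite gL/= ?in_itv/= ?h1 ?h3 ?(le_trans h2)// ?(le_trans h1)//.
  by rewrite distrC ger0_norm ?subr_ge0.
have -> : mdist p x = L by rewrite -c0 -(cL L)// g// subr0.
by move=> t0 tL; rewrite -{1}c0 -(cL L)// !g// subr0.
Qed.

Lemma generalized_ray_inner_end p x c t : generalized_ray p (Inner x) c ->
  mdist p x <= t -> c t = x.
Proof.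
move=> [c0 [L [L0 gL cL]]] xt; apply: (cL); apply: le_trans xt.
rewrite -c0 -(cL L)// gL/= ?in_itv/= ?lexx ?L0//.
by rewrite sub0r normrN ler_norm.
Qed.

Lemma generalized_ray_ideal p xi c : bd_class xi c -> c 0 = p ->
  generalized_ray p (Ideal xi) c.
Proof. by move=> h c0; split => //; split => //; exact: bd_ray h. Qed.

Lemma exists_generalized_inner p x : geodesic_space X ->
  exists c, generalized_ray p (Inner x) c.
Proof.
move=> /(_ p x)[L [c [L0 gc c0 cL]]].
exists (fun t => if t <= L then c t else x); split; first by rewrite L0.
exists L; split => //.
  move=> s t; rewrite /= !in_itv/= => /andP[s0 sL] /andP[t0 tL].
  by rewrite sL tL gc//= in_itv/= ?s0 ?t0.
by move=> t Lt; case: ifP => // tL; rewrite -cL; congr c; apply/eqP; rewrite eq_le tL.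
Qed.

Lemma increasing_seq_ge (phi : nat -> nat) : increasing_seq phi ->
  forall n, (n <= phi n)%N.
Proof.
move=> ip; elim=> [//|n IH]; apply: leq_ltn_trans IH _.
have := ip n.+1 n; rewrite !leEnat ltnn => /negbT.
by rewrite -ltnNge.
Qed.

Lemma increasing_seq_cvg (phi : nat -> nat) : increasing_seq phi ->
  phi n @[n --> \oo] --> \oo.
Proof.
move=> ip A [N _ NA]; exists N => // n /= Nn; apply: NA => /=.
exact: leq_trans Nn (increasing_seq_ge ip n).
Qed.

Lemma cone_cvg_subseq (z_ : nat -> compactification X) z (sigma : nat -> nat) :
  increasing_seq sigma -> cone_cvg z_ z -> cone_cvg (z_ \o sigma) z.
Proof.
move=> isig + p => /(_ p)[c cP cphi]; exists (c \o sigma).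
  by move=> n; exact: cP.
move=> phi iphi; apply: (cphi (sigma \o phi)) => m n.
exact: etrans (isig _ _) (iphi _ _).
Qed.

(** Otherwise a subsequence stays in a closed set that misses the limit. *)
Lemma cone_cvg_topology (z_ : nat -> compactification X) z :
  cone_cvg z_ z -> z_ @ \oo --> z.
Proof.
move=> zc B; rewrite nbhsE => -[U [oU Uz] UB].
have [//|nB] := pselect ((z_ @ \oo) B); exfalso.
have [|sigma isig sU] := @exists_subsequence (fun _ m => ~ U (z_ m)).
  move=> _ N; apply: contrapT => h; apply: nB; exists N => // m /= Nm; apply: UB.
  by apply: contrapT => mU; apply: h; exists m.
have : cone_closed (~` U) by rewrite -closed_coneE; exact: open_closedC.
move=> /(_ (z_ \o sigma) z); apply => //.
exact: cone_cvg_subseq.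
Qed.

(** Closed sets are sequentially closed by definition, so convergence along one
    subsequence is enough to test continuity. *)
Lemma cone_continuous (T : topologicalType) (F : compactification X -> T) :
  (forall (z_ : nat -> compactification X) z, cone_cvg z_ z ->
    exists psi : nat -> nat, F (z_ (psi n)) @[n --> \oo] --> F z) ->
  continuous F.
Proof.
move=> H; apply/continuous_closedP => A cA; rewrite closed_coneE => z_ z zA zc.
have [psi Fc] := H _ _ zc; apply: (closed_cvg _ cA _ _ Fc).
by apply: nearW => n; exact: zA.
Qed.

Lemma cone_cvg_rays (z_ : nat -> compactification X) z p : cone_cvg z_ z ->
  exists (psi : nat -> nat) (c_ : nat -> R -> X) (c : R -> X),
    [/\ increasing_seq psi, forall n, generalized_ray p (z_ (psi n)) (c_ n),
      generalized_ray p z c &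
      forall t, 0 <= t -> c_ n t @[n --> \oo] --> c t].
Proof.
move=> /(_ p)[c_ cP]; move=> /(_ id (fun _ _ => erefl))[psi ipsi [c gc cU]].
exists psi, (c_ \o psi), c; split; [exact: ipsi|by move=> n; exact: cP|exact: gc|].
move=> t t0; apply: (@uniform_cvg_pointwise _ _ _ _ [set t]) => //.
apply: cU; first exact: compact_set1.
by move=> s ->; rewrite /= in_itv/= andbT.
Qed.

End boundary_basics.

(** * Proper geodesic hyperbolic spaces *)

Section hyperbolic_space.
Context {R : realType} {X : metricType R}.
Implicit Types (x y p q : X) (c : R -> X) (xi eta : boundary X).
Implicit Types (z : compactification X).
Hypotheses (properX : proper_space X) (geoX : geodesic_space X).
Hypothesis hypX : gromov_hyperbolic X.

Lemma gromov_product_sym p x y : gromov_product p x y = gromov_product p y x.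
Proof. by rewrite /gromov_product (metric_sym x) (addrC (mdist p x)). Qed.

Lemma gromov_product_le p x y : gromov_product p x y <= mdist p x.
Proof. by have := metric_triangle p x y; rewrite /gromov_product; lra. Qed.

(** A segment from p to a point c n of a ray stays close to the ray: the points at
    time t both have Gromov product about t with c n. *)
Lemma ray_fellow c p : geodesic_ray c -> exists M, forall x (n t : R),
  0 <= t -> t <= n -> mdist p x = t -> mdist x (c n) = mdist p (c n) - t ->
  mdist x (c t) <= M.
Proof.
move=> gc; have [d dP] := hypX; exists (3 * mdist p (c 0) + 2 * d).
move=> x n t t0 tn px xcn; have n0 := le_trans t0 tn.
have := dP p x (c n) (c t); rewrite /gromov_product xcn px.
have e : mdist (c n) (c t) = n - t.
  by rewrite geodesic_rayE// ger0_norm ?subr_ge0.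
have h1 := metric_triangle p (c 0) (c t); rewrite geodesic_ray0// in h1.
have h2 := metric_triangle (c 0) p (c n); rewrite geodesic_ray0// in h2.
have h3 := metric_triangle (c 0) p (c t); rewrite geodesic_ray0// in h3.
rewrite (metric_sym _ p) in h2 h3; rewrite e.
move: (mdist p (c 0)) (mdist p (c t)) (mdist p (c n)) (mdist x (c t)) h1 h2 h3.
move=> D a b m h1 h2 h3; set A := (X in Num.min X _); set B := (X in Num.min _ X).
have [_|_] := leP A B; rewrite /A /B; lra.
Qed.

(** The segments from p to c n subconverge to a ray from p, which stays at bounded
    distance from c by [ray_fellow]. *)
Lemma cone_cvg_ray xi c : bd_class xi c ->
  cone_cvg (fun n : nat => Inner (c n%:R)) (Ideal xi).
Proof.
move=> xic p; have gc := bd_ray xic.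
have [s sP] := choice (fun n : nat => exists_generalized_inner p (c n%:R) geoX).
exists s => // phi iphi.
have ts n : truncated_ray (s n) := generalized_ray_truncated (sP n).
have s0 n : s n 0 = p by have [] := sP n.
have [psi ipsi [c' [tc' c'0 cU]]] :=
  @arzela_ascoli_rays R X p (fun n => s (phi n)) properX
    (fun n => ts _) (fun n => s0 _).
exists psi => //; exists c' => //.
have cP t : 0 <= t -> s (phi (psi n)) t @[n --> \oo] --> c' t.
  move=> t0; apply: (@uniform_cvg_pointwise _ _ (fun n => s (phi (psi n))) c' [set t] t) => //.
  apply: cU; first exact: compact_set1.
  by move=> u ->; rewrite /= in_itv/= andbT.
have far t : 0 <= t -> \forall n \near \oo,
    t <= (phi (psi n))%:R /\ t <= mdist p (c (phi (psi n))%:R).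
  move=> t0; pose N := (Num.truncn (t + mdist p (c 0))).+1.
  exists N => // n /= Nn.
  have h : t + mdist p (c 0) <= (phi (psi n))%:R.
    apply: le_trans (ltW (truncnS_gt _)) _; rewrite ler_nat.
    apply: leq_trans Nn (leq_trans (increasing_seq_ge ipsi n) _).
    exact: increasing_seq_ge.
  have := metric_triangle (c 0) p (c (phi (psi n))%:R).
  rewrite geodesic_ray0// (metric_sym (c 0) p).
  by have := mdist_ge0 p (c 0); lra.
have c't t : 0 <= t -> mdist p (c' t) = t.
  move=> t0.
  have h : mdist p (s (phi (psi n)) t) @[n --> \oo] --> mdist p (c' t).
    by apply: mdist_cvg (cP t t0); exact: cvg_cst.
  apply: (@cvg_unique _ (@Rhausdorff R) _ _ _ _ h).
  apply: cvg_near_cst; apply: filterS (far t t0) => n [_ h'].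
  by have [] := generalized_ray_inner (sP (phi (psi n))) t0 h'.
have gc' : geodesic_ray c'.
  have [[x]|//] := truncated_rayP tc'; rewrite c'0 => c'x.
  have := generalized_ray_inner_end c'x; move=> /(_ (mdist p x + 1)) E.
  have := c't (mdist p x + 1); rewrite E ?lerDl// => h.
  by have := h (ltac:(by rewrite addr_ge0// mdist_ge0)); lra.
apply: generalized_ray_ideal => //; apply/(bd_classE _ xic); split => //.
have [M MP] := ray_fellow p gc; exists M => t t0.
have h : mdist (c t) (s (phi (psi n)) t) @[n --> \oo] --> mdist (c t) (c' t).
  by apply: mdist_cvg (cP t t0); exact: cvg_cst.
apply: (cvgr_to_le h); apply: filterS (far t t0) => n [h1 h2].
have [h3 h4] := generalized_ray_inner (sP (phi (psi n))) t0 h2.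
by rewrite metric_sym; exact: (MP _ (phi (psi n))%:R).
Qed.

Lemma ray_cvg_boundary xi c : bd_class xi c ->
  Inner (c n%:R) @[n --> \oo] --> Ideal xi.
Proof. by move=> xic; apply: cone_cvg_topology; exact: cone_cvg_ray. Qed.

Lemma exists_ray_to p xi : exists2 c, bd_class xi c & c 0 = p.
Proof.
have [c _ xic] := bd_exists xi.
have [psi [c_ [c' [_ _ [c'0 [_ xic']] _]]]] := cone_cvg_rays p (cone_cvg_ray xic).
by exists c'.
Qed.

(** The values of a continuous extension of the Gromov product on the boundary are
    limits along rays, hence determined by the metric. *)
Section gromov_extension_values.
Variables (p : X) (f : compactification X * compactification X -> \bar R).
Hypothesis fp : is_gromov_extension p f.

Lemma ext_ideal_cvg xi eta c c' : bd_class xi c -> bd_class eta c' ->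
  (gromov_product p (c n%:R) (c' n%:R))%:E @[n --> \oo]
    --> f (Ideal xi, Ideal eta).
Proof.
move=> xic etac'; have [cf _ fE] := fp.
under eq_fun do rewrite -fE.
apply: (@cvg_comp _ _ _ (fun n : nat => (Inner (c n%:R), Inner (c' n%:R))) f
  _ _ _ _ (cf (Ideal xi, Ideal eta))).
by apply: (@cvg_pair _ _ _ \oo (nbhs (Ideal xi)) (nbhs (Ideal eta)));
  exact: ray_cvg_boundary.
Qed.

Lemma ext_inner_cvg y xi c : bd_class xi c ->
  (gromov_product p y (c n%:R))%:E @[n --> \oo] --> f (Inner y, Ideal xi).
Proof.
move=> xic; have [cf _ fE] := fp.
under eq_fun do rewrite -fE.
apply: (@cvg_comp _ _ _ (fun n : nat => (Inner y, Inner (c n%:R))) f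
  _ _ _ _ (cf (Inner y, Ideal xi))).
by apply: (@cvg_pair _ _ _ \oo (nbhs (Inner y)) (nbhs (Ideal xi)));
  [exact: cvg_cst|exact: ray_cvg_boundary].
Qed.

Lemma ext_inner_bounds y xi :
  (0 <= f (Inner y, Ideal xi))%E /\ (f (Inner y, Ideal xi) <= (mdist p y)%:E)%E.
Proof.
have [_ f0 _] := fp; split; first exact: f0.
have [c _ xic] := bd_exists xi.
apply: (closed_cvg _ (@closed_ereal_ge_ereal R (mdist p y)%:E) _ _
  (ext_inner_cvg (y := y) xic)).
by apply: nearW => n /=; rewrite lee_fin gromov_product_le.
Qed.

Lemma ext_inner_fin y xi :
  f (Inner y, Ideal xi) = (fine (f (Inner y, Ideal xi)))%:E.
Proof.
rewrite fineK//; have [h1 h2] := ext_inner_bounds y xi.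
by rewrite ge0_fin_numE//; apply: le_lt_trans h2 _; rewrite ltry.
Qed.

Lemma ext_ideal_sym xi eta : f (Ideal xi, Ideal eta) = f (Ideal eta, Ideal xi).
Proof.
have [c _ xic] := bd_exists xi; have [c' _ etac'] := bd_exists eta.
apply: (limits_eq (@ereal_hausdorff R) _ _ (ext_ideal_cvg xic etac')
  (ext_ideal_cvg etac' xic)) => n /=.
by rewrite gromov_product_sym.
Qed.

Lemma ext_idealxx xi : f (Ideal xi, Ideal xi) = +oo%E.
Proof.
have [c xic c0] := exists_ray_to p xi; have gc := bd_ray xic.
have := ext_ideal_cvg xic xic.
rewrite (_ : (fun n : nat => _) = fun n : nat => (n%:R)%:E); last first.
  apply/funext => n; rewrite /gromov_product mdistxx -c0 geodesic_ray0//.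
  by congr EFin; field.
move=> h; apply: (@cvg_unique _ (@ereal_hausdorff R) _ _ _ _ h).
apply/cvgeryP; exact: cvgr_idn.
Qed.

(** If the Gromov product of c n and c' n tends to infinity, then at each time t
    the chain c t, c n, c' n, c' t shows that c t and c' t have Gromov product t up
    to an additive constant. *)
Lemma ext_ideal_infty xi eta : f (Ideal xi, Ideal eta) = +oo%E -> xi = eta.
Proof.
have [c xic c0] := exists_ray_to p xi; have gc := bd_ray xic.
have [c' etac' c'0] := exists_ray_to p eta; have gc' := bd_ray etac'.
move=> foo; have := ext_ideal_cvg xic etac'; rewrite foo => /cvgeryP /cvgryPge H.
apply: (@bd_eq _ _ _ _ c' _ etac'); apply/(bd_classE _ xic); split => //.
have [d dP] := hypX; exists (4 * d) => t t0.
have d0 : 0 <= d.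
  have := dP p p p p; rewrite /gromov_product mdistxx min_l//.
  by rewrite lerBlDr lerDl.
have hc u v : 0 <= u -> u <= v -> gromov_product p (c u) (c v) = u.
  move=> u0 uv; have v0 := le_trans u0 uv.
  rewrite /gromov_product -c0 !geodesic_ray0// geodesic_rayE// distrC.
  by rewrite ger0_norm ?subr_ge0//; field.
have hc' u v : 0 <= u -> u <= v -> gromov_product p (c' u) (c' v) = u.
  move=> u0 uv; have v0 := le_trans u0 uv.
  rewrite /gromov_product -c'0 !geodesic_ray0// geodesic_rayE// distrC.
  by rewrite ger0_norm ?subr_ge0//; field.
have tn : \forall n \near \oo, t <= n%:R.
  exists (Num.truncn t).+1 => // n /= nt; apply: le_trans (ltW (truncnS_gt _)) _.
  by rewrite ler_nat.
have [n [h1 h2]] := @filter_ex _ \oo _ _ (filterI tn (H t)).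
have a1 := dP p (c t) (c n%:R) (c' n%:R).
have a2 := dP p (c t) (c' n%:R) (c' t).
rewrite (hc t n%:R)// in a1; rewrite (gromov_product_sym p (c' n%:R)) (hc' t n%:R)// in a2.
have E : mdist (c t) (c' t) = 2 * t - 2 * gromov_product p (c t) (c' t).
  by rewrite /gromov_product -{1}c0 -{1}c'0 !geodesic_ray0//; field.
rewrite E; rewrite min_l// in a1.
move: (gromov_product p (c t) (c' t)) (gromov_product p (c t) (c' n%:R)) a1 a2.
move=> a b a1; case: (leP b t) => _; lra.
Qed.

End gromov_extension_values.

Lemma ext_unique p f f' xi eta : is_gromov_extension p f ->
  is_gromov_extension p f' ->
  f (Ideal xi, Ideal eta) = f' (Ideal xi, Ideal eta).
Proof.
move=> fp f'p.
have [c _ xic] := bd_exists xi; have [c' _ etac'] := bd_exists eta.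
exact: (limits_eq (@ereal_hausdorff R) _ _ (ext_ideal_cvg fp xic etac')
  (ext_ideal_cvg f'p xic etac')).
Qed.

(** The value at q of the Busemann function of xi that vanishes at p; see
    [busemann_cvg]. *)
Definition busemann (f : compactification X * compactification X -> \bar R)
    (p q : X) xi : R := mdist p q - 2 * fine (f (Inner q, Ideal xi)).

Lemma busemann_cvg p f q xi c : is_gromov_extension p f -> bd_class xi c ->
  mdist q (c n%:R) - mdist p (c n%:R) @[n --> \oo] --> busemann f p q xi.
Proof.
move=> fp xic; have := ext_inner_cvg (y := q) fp xic.
rewrite (ext_inner_fin fp) => /fine_cvg h.
rewrite (_ : (fun n : nat => _) =
  (fun n : nat => mdist p q - 2 * gromov_product p q (c n%:R))); last first.
  by apply/funext => n; rewrite /gromov_product; field.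
by apply: cvgB; [exact: cvg_cst|apply: cvgM; [exact: cvg_cst|exact: h]].
Qed.

Lemma ext_change_base p q f g xi eta : is_gromov_extension p f ->
  is_gromov_extension q g ->
  (g (Ideal xi, Ideal eta) = f (Ideal xi, Ideal eta) +
    ((busemann f p q xi + busemann f p q eta) / 2)%:E)%E.
Proof.
move=> fp gq.
have [c _ xic] := bd_exists xi; have [c' _ etac'] := bd_exists eta.
have h1 := ext_ideal_cvg gq xic etac'.
have h2 := ext_ideal_cvg fp xic etac'.
have h3 : (((mdist q (c n%:R) - mdist p (c n%:R)) +
    (mdist q (c' n%:R) - mdist p (c' n%:R))) / 2)%:E @[n --> \oo] -->
    ((busemann f p q xi + busemann f p q eta) / 2)%:E.
  apply: cvg_EFin; first exact: nearW.
  by apply: cvgM; [apply: cvgD; exact: busemann_cvg|exact: cvg_cst].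
apply: (limits_eq (@ereal_hausdorff R) _ _ h1 (cvgeD _ h2 h3)) => [n /=|].
  by rewrite -EFinD; congr EFin; rewrite /gromov_product; field.
by rewrite fin_num_adde_defl.
Qed.

Lemma busemann_le p f q xi : is_gromov_extension p f ->
  `|busemann f p q xi| <= mdist p q.
Proof.
move=> fp; have [] := ext_inner_bounds fp q xi.
by rewrite (ext_inner_fin fp) !lee_fin ler_norml /busemann; lra.
Qed.

Hypothesis completeX : geodesically_complete X.

(** Extend the segment from p to q beyond q. *)
Lemma busemann_attained p f q : is_gromov_extension p f ->
  exists xi, busemann f p q xi = - mdist p q.
Proof.
move=> fp; have [L [c [L0 gc c0 cL]]] := geoX p q.
have [c' gc' c'E] := completeX L0 gc.
have rc' : geodesic_ray c' by move=> s t _ _; exact: gc'.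
exists (ray_boundary rc').
have c'0 : c' 0 = p by rewrite c'E ?lexx.
have c'L : c' L = q by rewrite c'E ?lexx ?L0.
have := busemann_cvg (q := q) fp (mem_ray_boundary rc') => h.
apply: (@cvg_unique _ (@Rhausdorff R) _ _ _ _ h).
apply: cvg_near_cst; exists (Num.truncn L).+1 => // n /= Ln.
have {}Ln : L <= n%:R.
  by apply: le_trans (ltW (truncnS_gt _)) _; rewrite ler_nat.
rewrite -c'0 -c'L !gc'// !sub0r normrN normrN (distrC L).
by rewrite !ger0_norm ?subr_ge0//; ring.
Qed.

(** A ray extends to a line: take a limit of lines that extend longer and longer
    initial segments of it.  The two ends of a line through p have Gromov
    product 0 at p. *)
Lemma exists_opposite p f xi : is_gromov_extension p f ->
  exists eta, f (Ideal xi, Ideal eta) = 0%E.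
Proof.
move=> fp; have [c xic c0] := exists_ray_to p xi; have gc := bd_ray xic.
have ext (n : nat) : exists g : R -> X, geodesic_on setT g /\
    forall t, 0 <= t <= n%:R -> g t = c t.
  have [] := @completeX 0 n%:R c (ler0n R n).
    move=> s t; rewrite /= !in_itv/= => /andP[s0 _] /andP[t0 _].
    exact: geodesic_rayE.
  by move=> g h1 h2; exists g.
have [g gP] := choice ext.
have [U UU ooU] := nat_ultrafilter.
have g0 n : g n 0 = p.
  by have [_ ->] := gP n; rewrite ?c0// lexx ler0n.
have [|h hP] := @proper_ultralimit _ _ nat U g p (fun t => `|t|) properX UU.
  by move=> n t; rewrite -(g0 n); have [-> //] := gP n; rewrite sub0r normrN.
have gh s t : mdist (h s) (h t) = `|s - t|.
  have : mdist (g n s) (g n t) @[n --> U] --> mdist (h s) (h t).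
    exact: mdist_cvg.
  rewrite (_ : (fun n => mdist (g n s) (g n t)) = fun=> `|s - t|); last first.
    by apply/funext => n; have [->] := gP n.
  by move=> H; apply: (@cvg_unique _ (@Rhausdorff R) _ _ _ _ H); exact: cvg_cst.
have hc t : 0 <= t -> h t = c t.
  move=> t0; apply: (@cvg_unique _ (@metric_hausdorff _ X) _ _ _ _ (hP t)).
  apply: cvg_near_cst; apply: ooU.
  exists (Num.truncn t).+1 => // n /= tn; have [_ ->//] := gP n.
  rewrite t0/=; apply: le_trans (ltW (truncnS_gt _)) _.
  by rewrite ler_nat.
pose k t := h (- t).
have gk : geodesic_ray k.
  by move=> s t _ _; rewrite gh opprK addrC distrC.
exists (ray_boundary gk).
have := ext_ideal_cvg fp xic (mem_ray_boundary gk) => H.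
apply: (@cvg_unique _ (@ereal_hausdorff R) _ _ _ _ H).
apply: cvg_near_cst; apply: nearW => n.
rewrite /gromov_product -c0 -hc// -(hc n%:R)// !gh /k !sub0r opprK.
rewrite normrN !ger0_norm ?addr_ge0//.
by congr EFin; field.
Qed.

End hyperbolic_space.

(** * The boundary of the Moebius space *)

Section moebius_boundary.
Context {R : realType} {Z : antipodalSpace R}.
Local Notation M := (moebius_space Z).
Implicit Types (e p q : M) (x y xi eta : Z) (c : R -> M) (b : boundary M).
Implicit Types (z w : compactification M).
Local Notation alpha := (@apt_fun R Z).

Hypothesis qmZ : quasi_metric Z.

Definition base_point : M :=
  MoebiusSpace (apt_antipodal Z) (fun _ _ _ _ _ => erefl).
Local Notation o := base_point.

Lemma mcoord_base x : mcoord o x = 0.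
Proof.
have sepa : separating alpha by have [] := apt_antipodal Z.
rewrite /mcoord (@derivativeE _ _ (apt_four Z) alpha _ (fun=> 1) sepa).
  by rewrite ln1 oppr0 mul0r.
split=> [y|y|y v]; [exact: cvg_cst|exact: ltr01|by rewrite !mul1r].
Qed.

Definition mradius e : R := mdist o e / 2.

Lemma mcoord_mradius e x : - mradius e <= mcoord e x /\ mcoord e x <= mradius e.
Proof.
have := mcoord_le o e x; have := mcoord_le e o x.
by rewrite mcoord_base (metric_sym e) /mradius; split; lra.
Qed.

Lemma mradius_lip e q : mradius q <= mradius e + mdist e q / 2.
Proof. by have := metric_triangle o e q; rewrite /mradius; lra. Qed.

Lemma mcoord_ray_between xi (t : R) c : geodesic_ray c -> 0 <= t ->
  mcoord (c 0) xi - t / 2 <= mcoord (c t) xi.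
Proof.
move=> gc t0; have := mcoord_le (c 0) (c t) xi.
by rewrite geodesic_ray0//; lra.
Qed.

Definition ends_at c xi : Prop :=
  forall t, 0 <= t -> mcoord (c t) xi = mcoord (c 0) xi - t / 2.

(** For each n the coordinate drops maximally between c 0 and c n at some point;
    take a limit of these points. *)
Lemma ray_endpoint c : geodesic_ray c -> exists xi, ends_at c xi.
Proof.
move=> gc.
have [x_ xP] := choice (fun n : nat => mcoord_min_attained (c 0) (c n%:R)).
have [U UU ooU] := nat_ultrafilter.
have [|xi _ xic] := @ultra_cvg_compact _ _ U x_ setT UU (@apt_compact R Z).
  exact: filterT.
exists xi => t t0.
have h : (fun n => mcoord (c t) (x_ n) - mcoord (c 0) (x_ n)) @ U -->
    mcoord (c t) xi - mcoord (c 0) xi.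
  by apply: cvgB; apply: (@cvg_comp _ _ _ x_ _ U _ _ xic); exact: mcoord_continuous.
suff E : mcoord (c t) xi - mcoord (c 0) xi = - (t / 2) by lra.
apply: (@cvg_unique _ (@Rhausdorff R) _ _ _ _ h).
apply: cvg_near_cst; apply: ooU; exists (Num.truncn t).+1 => // n /= tn.
have {}tn : t <= n%:R by apply: le_trans (ltW (truncnS_gt _)) _; rewrite ler_nat.
have h1 := mcoord_ray_between (x_ n) gc t0.
have h2 := xP n; rewrite geodesic_ray0// in h2.
have h3 := mcoord_le (c t) (c n%:R) (x_ n).
rewrite h2 geodesic_rayE// distrC ger0_norm ?subr_ge0// in h3.
by apply/eqP; rewrite eq_le; apply/andP; split; lra.
Qed.

(** Admissibility bounds alpha(xi, xi') by e^{O(1) - t} for all t. *)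
Lemma ends_at_unique c c' xi xi' : asymptotic c c' -> ends_at c xi ->
  ends_at c' xi' -> xi = xi'.
Proof.
move=> [B cc'] cxi c'xi; apply/alpha_eq0; apply/eqP.
rewrite eq_le alpha_ge0 andbT leNgt; apply/negP => a0.
pose C := mcoord (c 0) xi + mcoord (c' 0) xi' + B / 2.
pose t := Num.max 0 (C - ln (alpha xi xi') + 1).
have t0 : 0 <= t by rewrite le_max lexx.
have t1 : C - ln (alpha xi xi') + 1 <= t by rewrite le_max lexx orbT.
have := alpha_le_mcoord (c t) xi xi'.
rewrite -{1}(@lnK _ (alpha xi xi')) ?posrE// ler_expR cxi//.
have := mcoord_le (c t) (c' t) xi'; rewrite c'xi//.
by have := cc' t t0; move: t1; rewrite /C; lra.
Qed.

(** Choose x and y with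
    alpha(x, y) = e^{mcoord (c t) x + mcoord (c' t) y + mdist (c t) (c' t) / 2} and
    apply the quasi-metric inequality through xi. *)
Lemma ends_at_asymptotic c c' xi : geodesic_ray c -> geodesic_ray c' ->
  ends_at c xi -> ends_at c' xi -> asymptotic c c'.
Proof.
move=> gc gc' cxi c'xi; have [K K1 aK] := qmZ.
have K0 : 0 < K by exact: lt_le_trans K1.
exists (2 * (ln K + mradius (c 0) + mradius (c' 0))) => t t0.
have [x [y xy]] := alpha_mdist_attained (c t) (c' t).
have := aK x y xi; rewrite xy => h.
have {h} : expR (mcoord (c t) x + mcoord (c' t) y + mdist (c t) (c' t) / 2) <=
    K * Num.max (expR (mcoord (c t) x + mcoord (c t) xi))
                (expR (mcoord (c' t) xi + mcoord (c' t) y)).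
  apply: le_trans h _; rewrite ler_wpM2l ?(ltW K0)// ge_max !le_max.
  by rewrite (alpha_le_mcoord (c t) x xi) (alpha_le_mcoord (c' t) xi y) orbT.
have := mcoord_ray_between x gc t0; have := mcoord_ray_between y gc' t0.
rewrite -{1}(@lnK _ K) ?posrE// cxi// c'xi//.
have [h1 _] := mcoord_mradius (c 0) x; have [h2 _] := mcoord_mradius (c' 0) y.
have [_ h3] := mcoord_mradius (c 0) xi; have [_ h4] := mcoord_mradius (c' 0) xi.
move=> h5 h6; set A := (X in Num.max X _); set B := (X in Num.max _ X).
by case: (leP A B) => _; rewrite /A /B -expRD ler_expR; lra.
Qed.

Lemma boundary_endpoint b : exists xi, forall c, bd_class b c -> ends_at c xi.
Proof.
have [c gc bc] := bd_exists b; have [xi cxi] := ray_endpoint gc.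
exists xi => c' bc'; have [gc' cc'] := (bd_classE c' bc).1 bc'.
have [xi' c'xi'] := ray_endpoint gc'.
by rewrite (ends_at_unique cc' cxi c'xi').
Qed.

Definition endpoint b : Z := projT1 (cid (boundary_endpoint b)).

Lemma endpointP b c : bd_class b c -> ends_at c (endpoint b).
Proof. by rewrite /endpoint; case: cid => xi /= h; exact: h. Qed.

Lemma endpoint_inj : injective endpoint.
Proof.
move=> b b' bb'; have [c gc bc] := bd_exists b; have [c' gc' bc'] := bd_exists b'.
apply: (bd_eq (c := c')) => //; apply/(bd_classE _ bc); split => //.
apply: (@ends_at_asymptotic _ _ (endpoint b)) => //; first exact: endpointP.
by rewrite bb'; exact: endpointP.
Qed.

Lemma exists_ray_ending p xi : exists c,
  [/\ geodesic_ray c, c 0 = p & ends_at c xi].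
Proof.
have [c [gc c0 cxi]] := exists_ray qmZ p xi; exists c; split => // t t0.
by rewrite cxi// c0.
Qed.

Lemma endpoint_surj xi : exists b, endpoint b = xi.
Proof.
have [c [gc c0 cxi]] := exists_ray_ending o xi.
exists (ray_boundary gc); apply: ends_at_unique cxi; last first.
  exact: endpointP (mem_ray_boundary gc).
exact: asymptotic_refl.
Qed.

Lemma exists_ray_to_boundary p b : exists2 c, bd_class b c & c 0 = p.
Proof.
have [c [gc c0 cxi]] := exists_ray_ending p (endpoint b); exists c => //.
suff -> : b = ray_boundary gc by exact: mem_ray_boundary.
apply: endpoint_inj; apply: ends_at_unique cxi _; first exact: asymptotic_refl.
exact: endpointP (mem_ray_boundary gc).
Qed.

Lemma exists_generalized_ray p z : exists c, generalized_ray p z c.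
Proof.
case: z => [x|b].
  by apply: exists_generalized_inner; exact: moebius_geodesic.
have [c bc c0] := exists_ray_to_boundary p b.
by exists c; exact: generalized_ray_ideal.
Qed.

(** This is e^{-(z|x)} for the extended Gromov product based at [base_point] and x
    viewed as a boundary point. *)
Definition shadow z x : R :=
  match z with
  | Inner e => expR (mcoord e x - mradius e)
  | Ideal b => alpha x (endpoint b)
  end.

Lemma shadow_ge0 z x : 0 <= shadow z x.
Proof. by case: z => [e|b]; [exact: expR_ge0|exact: alpha_ge0]. Qed.

Lemma expR_lip (u v : R) : u <= 0 -> v <= 0 -> `|expR u - expR v| <= `|u - v|.
Proof.
wlog uv : u v / u <= v.
  move=> wl u0 v0; have [/wl|/ltW/wl] := leP u v; first exact.
  by rewrite distrC (distrC u); exact.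
move=> u0 v0; rewrite distrC (distrC u) !ger0_norm ?subr_ge0 ?ler_expR//.
have -> : expR u = expR v * expR (u - v) by rewrite -expRD; congr expR; ring.
have h1 := expR_ge1Dx (u - v); have h2 := expR_ge0 v.
have h3 : expR v <= 1 by rewrite expR_le1.
apply: (@le_trans _ _ (expR v * (v - u))).
  rewrite -[X in X - _]mulr1 -mulrBr; apply: ler_wpM2l => //; lra.
by apply: ler_piMl => //; rewrite subr_ge0.
Qed.

Lemma shadow_lip e q x :
  `|shadow (Inner e) x - shadow (Inner q) x| <= mdist e q.
Proof.
have [_ h1] := mcoord_mradius e x; have [_ h2] := mcoord_mradius q x.
apply: le_trans (expR_lip _ _) _; [by rewrite subr_le0|by rewrite subr_le0|].
have h3 := mcoord_le e q x; have h4 := mcoord_le q e x.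
have h5 := mradius_lip e q; have h6 := mradius_lip q e.
rewrite (metric_sym q e) in h4 h6; rewrite ler_norml.
move: (mcoord e x) (mcoord q x) (mradius e) (mradius q) (mdist e q) h3 h4 h5 h6.
by clear; move=> *; lra.
Qed.

(** By compactness, points that are close for [alpha] have uniformly close
    functions [alpha x]. *)
Lemma alpha_unif (r : R) : 0 < r -> exists2 d : R, 0 < d & forall y xi,
  alpha y xi <= d -> forall x, `|alpha x y - alpha x xi| <= r.
Proof.
move=> r0; apply: contrapT => H.
have {}H (n : nat) : exists yx : Z * Z, alpha yx.1 yx.2 <= n.+1%:R^-1 /\
    ~ (forall x, `|alpha x yx.1 - alpha x yx.2| <= r).
  apply: contrapT => h; apply: H; exists n.+1%:R^-1; first by rewrite invr_gt0.
  move=> y xi yxi; apply: contrapT => h'; apply: h.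
  by exists (y, xi).
have [f fP] := choice H.
have [U UU ooU] := nat_ultrafilter.
have [|y _ yc] := @ultra_cvg_compact _ _ U (fst \o f) setT UU (@apt_compact R Z).
  exact: filterT.
have [|xi _ xic] := @ultra_cvg_compact _ _ U (snd \o f) setT UU (@apt_compact R Z).
  exact: filterT.
have yxi : y = xi.
  apply/alpha_eq0; have [[ac _ _ _] _ _] := apt_antipodal Z.
  have h : alpha (f n).1 (f n).2 @[n --> U] --> alpha y xi.
    apply: (@cvg_comp _ _ _ (fun n => ((f n).1, (f n).2))
      (fun p : Z * Z => alpha p.1 p.2) _ _ _ _ (ac (y, xi))).
    by apply: (@cvg_pair _ _ _ U (nbhs y) (nbhs xi)).
  apply/eqP; rewrite eq_le alpha_ge0 andbT; apply/ler_addgt0Pl => s s0.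
  rewrite addr0; apply: (cvgr_to_le h); apply: ooU.
  exists (Num.truncn s^-1) => // n /= ns; have [h1 _] := fP n.
  apply: le_trans h1 _; rewrite -[leRHS]invrK lef_pV2 ?posrE ?invr_gt0//.
  apply: le_trans (ltW (truncnS_gt _)) _; by rewrite ler_nat.
have r2 : 0 < r / 2 by rewrite divr_gt0.
have n1 := yc _ (alpha_unif_near y r2).
have n2 := xic _ (alpha_unif_near xi r2).
have [n [/= a1 a2]] := @filter_ex _ U _ _ (@filterI _ U _ _ _ n1 n2).
have [_ nx] := fP n; apply: nx => x.
have := a1 x; have := a2 x; rewrite yxi (alpha_sym xi) (alpha_sym (f n).1).
rewrite (alpha_sym (f n).2) !ler_norml; lra.
Qed.

Lemma shadow_mul_ge e x y : alpha x y <= shadow (Inner e) x * expR (mcoord e y + mradius e).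
Proof.
apply: le_trans (alpha_le_mcoord e x y) _; rewrite -expRD ler_expR; lra.
Qed.

Lemma mradius_attained e : exists y, mcoord e y = - mradius e.
Proof.
have [y] := mcoord_min_attained o e; rewrite mcoord_base => E; exists y.
by rewrite E /mradius; lra.
Qed.

(** The factor e^{- mcoord e y - mradius e} in
    shadow e x = max_y alpha(x, y) e^{- mcoord e y - mradius e} is at most 1, is
    attained to be 1, and is small unless y is close to xi, because
    alpha(y, xi) <= e^{mcoord e y + mcoord e xi}.  So far out the shadow is that of
    the boundary point xi. *)
Lemma shadow_concentration (r C : R) : 0 < r -> exists T : R, forall e xi,
  T <= mradius e -> mcoord e xi <= - mradius e + C ->
  forall x, `|shadow (Inner e) x - alpha x xi| <= r.
Proof.
move=> r0; have [d d0 dP] := alpha_unif r0.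
exists ((C + `|ln (d * Num.min r 1)|) / 2) => e xi Te eC x.
have m0 : 0 < Num.min r 1 by rewrite lt_min r0 ltr01.
have small y : r <= expR (- mcoord e y - mradius e) \/ mcoord e y = - mradius e ->
    alpha y xi <= d.
  move=> hy; have h : Num.min r 1 <= expR (- mcoord e y - mradius e).
    case: hy => [h|->]; first by rewrite ge_min h.
    by rewrite opprK subrr expR0 ge_min lexx orbT.
  rewrite -(ler_pM2r m0).
  apply: (@le_trans _ _ (expR (mcoord e y + mcoord e xi) *
    expR (- mcoord e y - mradius e))).
    by apply: ler_pM; rewrite ?alpha_ge0 ?alpha_le_mcoord// ltW.
  rewrite -expRD -{1}(@lnK _ (d * Num.min r 1)) ?posrE ?mulr_gt0// ler_expR.
  have := ler_norm (- ln (d * Num.min r 1)); rewrite normrN.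
  move: Te eC; clear; lra.
have [y xy] := mcoord_antip e x.
have E : shadow (Inner e) x = alpha x y * expR (- mcoord e y - mradius e).
  by rewrite xy -expRD /=; congr expR; ring.
have w1 v : expR (- mcoord e v - mradius e) <= 1.
  by have [h _] := mcoord_mradius e v; rewrite expR_le1; lra.
have [y0 y0E] := mradius_attained e.
have h0 : alpha x y0 <= shadow (Inner e) x.
  have := shadow_mul_ge e x y0; rewrite y0E addrC subrr expR0 mulr1//.
have h1 := dP _ _ (small y0 (or_intror y0E)) x.
have up : shadow (Inner e) x <= alpha x xi + r.
  rewrite E; have [ry|/ltW ry] := leP r (expR (- mcoord e y - mradius e)).
    have := dP _ _ (small y (or_introl ry)) x; rewrite ler_norml => h.
    apply: le_trans (ler_piMr (alpha_ge0 _ _) (w1 y)) _; lra.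
  apply: le_trans (ler_piMl (expR_ge0 _) (alpha_le1 x y)) _.
  by apply: le_trans ry _; rewrite lerDr alpha_ge0.
by move: h1 h0 up; rewrite !ler_norml; lra.
Qed.

(** The point where the coordinate drops maximally from p to the end of the ray is
    such a point for every intermediate time as well; both shadows are close to
    its shadow. *)
Lemma shadow_ray_approx p (r : R) : 0 < r -> exists T : R, forall z c t,
  generalized_ray p z c -> T <= t ->
  forall x, `|shadow z x - shadow (Inner (c t)) x| <= r.
Proof.
move=> r0; have r2 : 0 < r / 2 by rewrite divr_gt0.
have [T TP] := shadow_concentration (2 * mradius p) r2.
exists (Num.max 0 (2 * (T + mradius p))) => z c t pzc; rewrite ge_max => /andP[t0 Tt] x.
have cP e s xi : Num.max 0 (2 * (T + mradius p)) <= s -> mdist p e = s ->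
    mcoord e xi = mcoord p xi - s / 2 ->
    `|shadow (Inner e) x - alpha x xi| <= r / 2.
  rewrite ge_max => /andP[s0 Ts] pes exi.
  have h1 := metric_triangle p o e; have h2 := mradius_lip p e.
  rewrite (metric_sym p o) pes in h1; rewrite pes in h2.
  have [_ h3] := mcoord_mradius p xi.
  by apply: TP; [|rewrite exi]; move: h1 h2 h3; rewrite /mradius in Ts *; lra.
case: z pzc => [e|b] pzc.
  have [et|/ltW te] := leP (mdist p e) t.
    by rewrite (generalized_ray_inner_end pzc et) subrr normr0 ltW.
  have [pct cte] := generalized_ray_inner pzc t0 te.
  have [xi exi] := mcoord_min_attained p e.
  have h1 : `|shadow (Inner e) x - alpha x xi| <= r / 2.
    by apply: cP exi => //; rewrite ge_max (le_trans t0)// (le_trans Tt).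
  have h2 : `|shadow (Inner (c t)) x - alpha x xi| <= r / 2.
    apply: (cP _ t) => //; first by rewrite ge_max t0.
    have := mcoord_le (c t) e xi; have := mcoord_le p (c t) xi; rewrite pct cte exi.
    by move=> h3 h4; apply/eqP; rewrite eq_le; apply/andP; split; lra.
  move: (shadow (Inner e) x) (shadow (Inner (c t)) x) (alpha x xi) h1 h2.
  by clear; move=> u v k h1 h2; rewrite !ler_norml in h1 h2 *; lra.
have [c0 [gc bc]] := pzc.
have := cP (c t) t (endpoint b); rewrite ge_max t0 Tt -{1}c0 geodesic_ray0//.
rewrite -c0 endpointP// => /(_ isT erefl erefl) h.
by rewrite distrC; apply: le_trans h _; lra.
Qed.

Lemma shadow_ray_limit p (z_ : nat -> compactification M) z
    (c_ : nat -> R -> M) c (r : R) : 0 < r ->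
  (forall n, generalized_ray p (z_ n) (c_ n)) -> generalized_ray p z c ->
  (forall t, 0 <= t -> c_ n t @[n --> \oo] --> c t) ->
  \forall n \near \oo, forall x, `|shadow (z_ n) x - shadow z x| <= r.
Proof.
move=> r0 zc_ zc cc; have r3 : 0 < r / 3 by rewrite divr_gt0.
have [T TP] := shadow_ray_approx p r3; pose t := Num.max 0 T.
have t0 : 0 <= t by rewrite le_max lexx.
have Tt : T <= t by rewrite le_max lexx orbT.
have h : \forall n \near \oo, mdist (c t) (c_ n t) < r / 3.
  exact: (metricType_numDomainType.cvgr_dist_lt (cc t t0)).
apply: filterS h => n h x.
have h1 := TP _ _ _ (zc_ n) Tt x; have h2 := TP _ _ _ zc Tt x.
have h3 := shadow_lip (c t) (c_ n t) x.
move: (shadow (Inner (c t)) x) (shadow (Inner (c_ n t)) x) (shadow (z_ n) x)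
  (shadow z x) (mdist (c t) (c_ n t)) h h1 h2 h3.
by clear; move=> u v k l m h h1 h2 h3; rewrite !ler_norml in h1 h2 h3 *; lra.
Qed.

End moebius_boundary.

(** * Boundary continuity of the Moebius space *)

Section negative_logarithm.
Context {R : realType}.

(** The inverse of u |-> e^{-u}, extended by +oo to the negative arguments so as
    to be continuous on the whole line. *)
Definition neg_ln (u : R) : \bar R := if u <= 0 then +oo%E else (- ln u)%:E.

Lemma neg_ln_expR (u : R) : neg_ln (expR (- u)) = u%:E.
Proof. by rewrite /neg_ln leNgt expR_gt0/= expRK opprK. Qed.

Lemma neg_ln_ge0 (u : R) : u <= 1 -> (0 <= neg_ln u)%E.
Proof.
move=> u1; rewrite /neg_ln; case: ifP => _; first exact: leey.
by rewrite lee_fin oppr_ge0 ln_le0.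
Qed.

Lemma neg_lnK (u : R) : 0 <= u -> fine (expeR (- neg_ln u)%E) = u.
Proof.
move=> u0; rewrite /neg_ln; case: ifPn => [u0'|].
  by rewrite /=; apply/eqP; rewrite eq_le u0 u0'.
by rewrite -ltNge => up; rewrite /= opprK lnK.
Qed.

Lemma continuous_neg_ln : continuous neg_ln.
Proof.
move=> u; rewrite /continuous_at; have [u0|u0|u0] := ltgtP u 0.
- apply: cvg_near_cst; rewrite /neg_ln (ltW u0).
  have : \forall v \near u, v < 0 by exact: lt_nbhsl.
  by apply: filterS => v v0; rewrite (ltW v0).
- have E : \forall v \near u, (- ln v)%:E = neg_ln v.
    have : \forall v \near u, 0 < v by exact: lt_nbhsr.
    by apply: filterS => v v0; rewrite /neg_ln leNgt v0.
  rewrite {2}/neg_ln leNgt u0/=; apply: cvg_trans (near_eq_cvg E) _.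
  by apply: cvg_EFin; [exact: nearW|apply: cvgN; exact: continuous_ln].
- rewrite u0 {2}/neg_ln lexx; apply/cvgeyPge => A.
  have : \forall v \near (0 : R), v < expR (- A) by apply: lt_nbhsl; exact: expR_gt0.
  apply: filterS => v vA; rewrite /neg_ln; case: ifPn => [_|]; first exact: leey.
  rewrite -ltNge => v0; rewrite lee_fin lerNr -ler_expR lnK ?posrE//.
  exact: ltW.
Qed.

Lemma fine_expeRN_continuous (x : \bar R) : (0 <= x)%E ->
  {for x, continuous (fun x => fine (expeR (- x)%E))}.
Proof.
case: x => [r _|_|//]; rewrite /prop_for /continuous_at.
  have h : {for r, continuous (fun r : R => expR (- r))}.
    apply: (@continuous_comp _ _ _ (fun r : R => - r) (@expR R)).
      by apply: cvgN; exact: cvg_id.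
    exact: continuous_expR.
  by move=> A HA; exact: (h A HA).
move=> A [e /= e0 eA]; exists (- ln e); split; first exact: num_real.
move=> y hy; apply: eA => /=; case: y hy => [s||]//=; last by rewrite subrr normr0.
rewrite lte_fin => h; rewrite sub0r normrN gtr0_norm ?expR_gt0//.
by rewrite -[ltRHS]lnK ?posrE// ltr_expR; lra.
Qed.

End negative_logarithm.

Section moebius_compactification.
Context {R : realType} {Z : antipodalSpace R}.
Local Notation M := (moebius_space Z).
Implicit Types (e p q : M) (x y xi eta : Z) (c : R -> M) (b : boundary M).
Implicit Types (z w : compactification M).
Local Notation alpha := (@apt_fun R Z).
Local Notation o := (@base_point R Z).

Hypothesis qmZ : quasi_metric Z.

(** A point z is a max-plus measure on Z, a boundary point being a Dirac mass;
    shadows and Gromov products are its integrals against ln alpha, in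
    multiplicative notation.  See [shadow_attained] and [pairing_attained]. *)
Definition weight z y : R :=
  match z with
  | Inner e => expR (- mcoord e y - mradius e)
  | Ideal b => (y == endpoint b)%:R
  end.

Lemma weight_ge0 z y : 0 <= weight z y.
Proof. by case: z => [e|b] /=; [exact: expR_ge0|case: eqP]. Qed.

Lemma weight_le1 z y : weight z y <= 1.
Proof.
case: z => [e|b] /=; last by case: eqP.
by have [h _] := mcoord_mradius e y; rewrite expR_le1; lra.
Qed.

Lemma shadow_ge z x y : alpha x y * weight z y <= shadow z x.
Proof.
case: z => [e|b] /=; last first.
  by case: eqP => [->|_]; rewrite ?mulr1 ?mulr0 ?alpha_ge0.
apply: le_trans (ler_wpM2r (expR_ge0 _) (alpha_le_mcoord e x y)) _.
by rewrite -expRD ler_expR; lra.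
Qed.

Lemma shadow_attained z x : exists y, shadow z x = alpha x y * weight z y.
Proof.
case: z => [e|b] /=; last by exists (endpoint b); rewrite eqxx mulr1.
have [y xy] := mcoord_antip e x; exists y; rewrite xy -expRD.
by congr expR; ring.
Qed.

(** This is e^{-(z|w)} for the extended Gromov product based at [base_point]. *)
Definition pairing z w : R :=
  match z, w with
  | Inner e, Inner q => expR (- gromov_product o e q)
  | _, Ideal b => shadow z (endpoint b)
  | Ideal b, _ => shadow w (endpoint b)
  end.

Lemma pairing_sym z w : pairing z w = pairing w z.
Proof.
case: z w => [e|b] [q|b']; rewrite /pairing; [|by []|by []|exact: alpha_sym].
by rewrite gromov_product_sym.
Qed.

Lemma pairing_ge z w x y : alpha x y * weight z x * weight w y <= pairing z w.
Proof.
wlog : z w x y / (exists b, w = Ideal b) \/ exists e q, z = Inner e /\ w = Inner q.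
  move=> H; case: z w => [e|b] [q|b'].
  - by apply: H; right; exists e, q.
  - by apply: H; left; exists b'.
  - rewrite pairing_sym mulrAC (alpha_sym x); apply: H; left.
    by exists b.
  - by apply: H; left; exists b'.
case=> [[b ->]|[e [q [-> ->]]]].
  have -> : pairing z (Ideal b) = shadow z (endpoint b) by case: (z).
  rewrite /=; case: eqP => [->|_]; last by rewrite mulr0 shadow_ge0.
  by rewrite mulr1 alpha_sym shadow_ge.
rewrite /= -mulrA -expRD.
apply: le_trans (ler_wpM2r (expR_ge0 _) (alpha_le_mdist e q x y)) _.
rewrite -expRD ler_expR /gromov_product /mradius.
by move: (mcoord e x) (mcoord q y) (mdist e q) (mdist o e) (mdist o q) => *; lra.
Qed.

Lemma pairing_attained z w :
  exists x y, pairing z w = alpha x y * weight z x * weight w y.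
Proof.
wlog : z w / (exists b, w = Ideal b) \/ exists e q, z = Inner e /\ w = Inner q.
  move=> H; case: z w => [e|b] [q|b'].
  - by apply: H; right; exists e, q.
  - by apply: H; left; exists b'.
  - have [|x [y xy]] := H (Inner q) (Ideal b); first by left; exists b.
    by exists y, x; rewrite pairing_sym xy mulrAC (alpha_sym x).
  - by apply: H; left; exists b'.
case=> [[b ->]|[e [q [-> ->]]]].
  have -> : pairing z (Ideal b) = shadow z (endpoint b) by case: (z).
  have [x ->] := shadow_attained z (endpoint b).
  by exists x, (endpoint b); rewrite /= eqxx mulr1 alpha_sym.
have [x [y xy]] := alpha_mdist_attained e q; exists x, y.
rewrite /= xy -!expRD; congr expR; rewrite /gromov_product /mradius.
by field.
Qed.

(** Integrating in the other variable first, [pairing] depends on z only through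
    its shadow, and the weights are at most 1. *)
Lemma pairing_lip z z' w (r : R) :
  (forall x, `|shadow z x - shadow z' x| <= r) -> pairing z w <= pairing z' w + r.
Proof.
move=> H; have [x [y ->]] := pairing_attained z w.
have [x' x'E] := shadow_attained z' y.
have r0 : 0 <= r by apply: le_trans (H x).
apply: (@le_trans _ _ ((shadow z' y + r) * weight w y)).
  apply: ler_wpM2r; first exact: weight_ge0.
  rewrite alpha_sym; apply: le_trans (shadow_ge z y x) _.
  by have := H y; rewrite ler_norml; lra.
rewrite mulrDl; apply: lerD; last by apply: ler_piMr => //; exact: weight_le1.
by rewrite x'E (alpha_sym y); exact: pairing_ge.
Qed.

(** Moving the base point from [base_point] to p divides e^{-(z|w)} by the product
    of the scales of z and w.  By [scale_ge] and [scale_attained] the scale is a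
    maximum of multiples of values of the shadow, hence as continuous as the
    shadow. *)
Definition scale p z : R :=
  match z with
  | Inner e => expR ((mdist p e - mdist o e) / 2)
  | Ideal b => expR (mcoord p (endpoint b))
  end.

Lemma scale_gt0 p z : 0 < scale p z.
Proof. by case: z => [e|b]; exact: expR_gt0. Qed.

Lemma scale_ge p z x : shadow z x * expR (- mcoord p x) <= scale p z.
Proof.
case: z => [e|b] /=.
  rewrite -expRD ler_expR; have := mcoord_le e p x.
  by rewrite (metric_sym e p) /mradius; lra.
apply: le_trans (ler_wpM2r (expR_ge0 _) (alpha_le_mcoord p x (endpoint b))) _.
by rewrite -expRD ler_expR; lra.
Qed.

Lemma scale_attained p z :
  exists x, scale p z = shadow z x * expR (- mcoord p x).
Proof.
case: z => [e|b] /=.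
  have [x E] := mcoord_min_attained e p; exists x.
  rewrite -expRD; congr expR; rewrite E (metric_sym e p) /mradius; lra.
have [x E] := mcoord_antip p (endpoint b); exists x.
by rewrite alpha_sym E -expRD; congr expR; ring.
Qed.

Lemma weight_scale p z y : weight z y * expR (mcoord p y) <= scale p z.
Proof.
have [x E] := mcoord_antip p y; apply: le_trans (scale_ge p z x).
have -> : expR (mcoord p y) = alpha x y * expR (- mcoord p x).
  by rewrite alpha_sym E -expRD; congr expR; ring.
rewrite mulrA; apply: ler_wpM2r; first exact: expR_ge0.
by rewrite mulrC shadow_ge.
Qed.

Lemma pairing_scale p z w : pairing z w <= scale p z * scale p w.
Proof.
have [x [y ->]] := pairing_attained z w.
apply: le_trans (ler_pM _ _ (weight_scale p z x) (weight_scale p w y)).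
- rewrite (_ : _ * _ * (_ * _) = expR (mcoord p x) * expR (mcoord p y) *
    (weight z x * weight w y)); last by ring.
  rewrite -mulrA; apply: ler_wpM2r; first by rewrite mulr_ge0 ?weight_ge0.
  by rewrite -expRD alpha_le_mcoord.
- by rewrite mulr_ge0 ?weight_ge0 ?expR_ge0.
- by rewrite mulr_ge0 ?weight_ge0 ?expR_ge0.
Qed.

Lemma scale_lip p z z' (r : R) :
  (forall x, `|shadow z x - shadow z' x| <= r) ->
  scale p z <= scale p z' + r * expR (mradius p).
Proof.
move=> H; have [x ->] := scale_attained p z.
have r0 : 0 <= r by apply: le_trans (H x).
apply: (@le_trans _ _ ((shadow z' x + r) * expR (- mcoord p x))).
  by apply: ler_wpM2r; [exact: expR_ge0|have := H x; rewrite ler_norml; lra].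
rewrite mulrDl; apply: lerD; first exact: scale_ge.
apply: ler_wpM2l => //; rewrite ler_expR.
by have [h _] := mcoord_mradius p x; lra.
Qed.

(** Sequential continuity of the shadow for the uniform norm, from
    [shadow_ray_limit], in terms of neighbourhoods. *)
Lemma shadow_near z (r : R) : 0 < r ->
  \forall z' \near z, forall x, `|shadow z' x - shadow z x| <= r.
Proof.
move=> r0; pose A : set (compactification M) :=
  [set z' | forall d, d < r -> exists x, d < `|shadow z' x - shadow z x|].
have cA : closed A.
  rewrite closed_coneE => z_ z' zA zc d dr.
  have [psi [c_ [c [_ h1 h2 h3]]]] := cone_cvg_rays o zc.
  have r2 : 0 < (r - d) / 2 by rewrite divr_gt0// subr_gt0.
  have [n nP] := @filter_ex _ \oo _ _ (shadow_ray_limit r2 h1 h2 h3).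
  have [|x xP] := zA (psi n) ((r + d) / 2); first by move: dr; lra.
  exists x; have := nP x.
  have := ler_distD (shadow z' x) (shadow (z_ (psi n)) x) (shadow z x).
  by move: xP; clear; lra.
have zA : \forall z' \near z, (~` A) z'.
  apply: open_nbhs_nbhs; split; first exact: closed_openC.
  by move=> /(_ 0 r0)[x]; rewrite subrr normr0 ltxx.
apply: filterS zA => z' nA x; rewrite leNgt; apply/negP => h; apply: nA => d dr.
by exists x; exact: lt_trans dr h.
Qed.

Lemma scale_continuous p : continuous (scale p).
Proof.
move=> z; apply/(@cvgrPdist_le _ _ _ (nbhs z) (nbhs_filter z)) => r r0.
have r1 : 0 < r * expR (- mradius p) by rewrite mulr_gt0 ?expR_gt0.
apply: filterS (shadow_near z r1) => z' H.
have H' x : `|shadow z x - shadow z' x| <= r * expR (- mradius p) by rewrite distrC.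
have := scale_lip p H; have := scale_lip p H'.
by rewrite -mulrA -expRD addNr expR0 mulr1 ler_norml; lra.
Qed.

Lemma pairing_continuous : continuous (fun zw => pairing zw.1 zw.2).
Proof.
move=> [z w]; apply/(@cvgrPdist_le _ _ _ (nbhs (z, w)) (nbhs_filter (z, w))) => r r0.
have r2 : 0 < r / 2 by rewrite divr_gt0.
exists ([set z' | forall x, `|shadow z' x - shadow z x| <= r / 2],
  [set w' | forall x, `|shadow w' x - shadow w x| <= r / 2]).
  by split; exact: shadow_near.
move=> [z' w'] /= [Hz Hw].
have Hz' x : `|shadow z x - shadow z' x| <= r / 2 by rewrite distrC.
have Hw' x : `|shadow w x - shadow w' x| <= r / 2 by rewrite distrC.
have := pairing_lip w Hz; have := pairing_lip w Hz'.
have := pairing_lip z' Hw; have := pairing_lip z' Hw'.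
rewrite !(pairing_sym _ z') ler_norml.
by move: (pairing z w) (pairing z' w) (pairing z' w'); clear; move=> *; lra.
Qed.

Definition moebius_gromov p (zw : compactification M * compactification M) :
    \bar R :=
  neg_ln (pairing zw.1 zw.2 / (scale p zw.1 * scale p zw.2)).

Lemma moebius_gromovP p : is_gromov_extension p (moebius_gromov p).
Proof.
split.
- move=> zw; apply: (@continuous_comp _ _ _
    (fun zw => pairing zw.1 zw.2 / (scale p zw.1 * scale p zw.2)) neg_ln);
    last exact: continuous_neg_ln.
  apply: cvgM; first exact: pairing_continuous.
  apply: cvgV; first by rewrite mulf_neq0// gt_eqF// scale_gt0.
  apply: cvgM.
    by apply: (@continuous_comp _ _ _ fst (scale p)); [exact: cvg_fst|exact: scale_continuous].
  by apply: (@continuous_comp _ _ _ snd (scale p)); [exact: cvg_snd|exact: scale_continuous].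
- move=> zw; apply: neg_ln_ge0; rewrite ler_pdivrMr ?mulr_gt0 ?scale_gt0//.
  by rewrite mul1r pairing_scale.
- move=> x y; rewrite /moebius_gromov /= -expRD -expRB -[RHS]neg_ln_expR.
  by congr (neg_ln (expR _)); rewrite /gromov_product; field.
Qed.

Lemma moebius_good : good_gromov_hyperbolic (moebius_space Z).
Proof.
split.
- exact: moebius_proper.
- exact: moebius_geodesic.
- exact: moebius_complete.
- exact: moebius_hyperbolic.
- by move=> p; exists (moebius_gromov p); exact: moebius_gromovP.
Qed.

Lemma visual_fun_moebius p b b' :
  visual_fun p b b' = p (endpoint b) (endpoint b').
Proof.
have fp : is_gromov_extension p (gromov_extension p).
  exact: (xgetI (fun=> 0%E) (moebius_gromovP p)).
rewrite /visual_fun (ext_unique moebius_proper moebius_geodesic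
  (moebius_hyperbolic qmZ) b b' fp (moebius_gromovP p)).
rewrite /moebius_gromov neg_lnK/=; last first.
  by rewrite divr_ge0 ?mulr_ge0 ?alpha_ge0 ?expR_ge0.
by rewrite alpha_sym mcoordE alpha_sym -expRD -expRN; congr (_ * expR _); ring.
Qed.

(** Shadows determine points even up to a factor: adding a nonzero constant
    destroys extremality, and the shadow of a boundary point vanishes exactly at
    that point. *)
Lemma shadow_projective_inj z w :
  (forall x y, shadow z x * shadow w y = shadow z y * shadow w x) -> z = w.
Proof.
have mixed e b : ~ forall x y, shadow (Inner e) x * shadow (Ideal b) y =
    shadow (Inner e) y * shadow (Ideal b) x.
  move=> H; have [x E] := alpha_antip (endpoint b).
  have := H (endpoint b) x; rewrite /= alphaxx mulr0 alpha_sym E mulr1.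
  by move/eqP; rewrite expR_eq0.
case: z w => [e|b] [q|b'] H.
- congr Inner; apply: mcoord_inj; apply/funext => x.
  have k y : mcoord e y = mcoord q y + (mcoord e x - mcoord q x).
    have := H x y; rewrite /= -!expRD => /expR_inj; lra.
  have [y1 E1] := mcoord_antip e x; have [y2 E2] := mcoord_antip q x.
  have := alpha_le_mcoord q x y1; rewrite E1 ler_expR.
  have := alpha_le_mcoord e x y2; rewrite E2 ler_expR.
  by have := k y1; have := k y2; move=> *; apply/eqP; rewrite eq_le; apply/andP; split; lra.
- by have := mixed e b' H.
- by have [] := mixed q b; move=> x y; rewrite mulrC -H mulrC.
- congr Ideal; apply: (endpoint_inj qmZ).
  have [x E] := alpha_antip (endpoint b').
  apply/alpha_eq0; have := H (endpoint b') x; rewrite /= alphaxx mulr0.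
  by rewrite (alpha_sym x (endpoint b')) E mulr1 alpha_sym.
Qed.

(** Rays from p to w_ n subconverge to a ray towards some w'.  The shadow of w' is
    proportional to that of w, so w' = w. *)
Lemma shadow_cone_cvg (w_ : nat -> compactification M) w :
  (forall x y, shadow (w_ n) x * shadow w y - shadow (w_ n) y * shadow w x
     @[n --> \oo] --> (0 : R)) ->
  cone_cvg w_ w.
Proof.
move=> H p; have [c cP] := choice (fun n => exists_generalized_ray qmZ p (w_ n)).
exists c => // phi iphi.
have [psi ipsi [c' [tc' c'0 cU]]] :=
  @arzela_ascoli_rays R M p (fun n => c (phi n)) moebius_proper
    (fun n => generalized_ray_truncated (cP _)) (fun n => (cP (phi n)).1).
exists psi => //; exists c' => //.
have [w' w'c'] : exists w', generalized_ray p w' c'.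
  have [[x]|gc'] := truncated_rayP tc'; first by rewrite c'0; exists (Inner x).
  exists (Ideal (ray_boundary gc')); apply: generalized_ray_ideal => //.
  exact: mem_ray_boundary.
have lim x : shadow (w_ (phi (psi n))) x @[n --> \oo] --> shadow w' x.
  apply/cvgrPdist_le => r r0.
  have := @shadow_ray_limit _ _ p (fun n => w_ (phi (psi n))) w'
    (fun n => c (phi (psi n))) c' r r0 (fun n => cP _) w'c'.
  move=> h; have {}h := h (fun t t0 => @uniform_cvg_pointwise _ _
    (fun n => c (phi (psi n))) c' [set t] t
    (cU [set t] (@compact_set1 _ t) (ltac:(by move=> s ->; rewrite /= in_itv/= andbT))) erefl).
  by apply: filterS h => n /(_ x); rewrite distrC.
suff -> : w = w' by [].
apply/esym/shadow_projective_inj => x y; apply/eqP; rewrite -subr_eq0; apply/eqP.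
have h1 : shadow (w_ (phi (psi n))) x * shadow w y -
    shadow (w_ (phi (psi n))) y * shadow w x @[n --> \oo] -->
    shadow w' x * shadow w y - shadow w' y * shadow w x.
  by apply: cvgB; apply: cvgM; [exact: lim|exact: cvg_cst|exact: lim|exact: cvg_cst].
apply: (@cvg_unique _ (@Rhausdorff R) _ _ _ _ h1).
apply: (@cvg_comp _ _ _ (fun n => phi (psi n)) _ _ _ _ _ (H x y)).
apply: (@cvg_comp _ _ _ psi phi _ \oo); exact: increasing_seq_cvg.
Qed.

End moebius_compactification.

(** * Maximality *)

Lemma Ideal_continuous (R : realType) (X : metricType R) :
  continuous (@Ideal R X).
Proof. exact: initial_continuous. Qed.

Lemma metrizable_closed (R : realType) (S : topologicalType) (A : set S) :
  metrizable R S ->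
  (forall (x_ : nat -> S) x, (forall n, A (x_ n)) -> x_ @ \oo --> x -> A x) ->
  closed A.
Proof.
move=> [d [_ _ _ nb]] H x clx.
have ex (n : nat) : exists y, A y /\ d x y < n.+1%:R^-1.
  have [|y [Ay xy]] := clx [set y | d x y < n.+1%:R^-1].
    by rewrite nb; exists n.+1%:R^-1 => //=; rewrite invr_gt0.
  by exists y.
have [f fP] := choice ex.
apply: (H f) => [n|B]; first by have [] := fP n.
rewrite nb => -[e /= e0 eB]; exists (Num.truncn e^-1) => // n /= en.
apply: eB => /=; have [_ h] := fP n; apply: lt_le_trans h _.
rewrite -[leRHS]invrK lef_pV2 ?posrE ?invr_gt0//.
by apply: le_trans (ltW (truncnS_gt _)) _; rewrite ler_nat.
Qed.

Section maximality.
Context {R : realType} {Z : antipodalSpace R} {Y : metricType R}.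
Local Notation M := (moebius_space Z).
Local Notation alpha := (@apt_fun R Z).
Local Notation o := (@base_point R Z).
Hypotheses (qmZ : quasi_metric Z) (goodY : good_gromov_hyperbolic Y).
Variables (g : boundary Y -> boundary M) (k : boundary M -> boundary Y).
Hypothesis k_continuous : continuous k.
Hypotheses (gK : cancel g k) (kK : cancel k g) (moebius_g : moebius_map g).
Implicit Types (x : Z) (y : Y).

Let properY := good_proper goodY.
Let geoY := good_geodesic goodY.
Let completeY := good_complete goodY.
Let hypY := good_hyperbolic goodY.

Let f y := gromov_extension y.

Let fP y : is_gromov_extension y (f y).
Proof.
have [h hP] := good_boundary_continuous goodY y.
exact: (xgetI (fun=> 0%E) hP).
Qed.

Let ideal_pt x : boundary M := projT1 (cid (endpoint_surj qmZ x)).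

Let ideal_ptK x : endpoint (ideal_pt x) = x.
Proof. by rewrite /ideal_pt; case: cid. Qed.

Let endpointK b : ideal_pt (endpoint b) = b.
Proof. by apply: (endpoint_inj qmZ); rewrite ideal_ptK. Qed.

Let ideal_pt_continuous : continuous ideal_pt.
Proof.
apply: continuous_comp_initial; apply/continuous_closedP => A cA.
apply: (metrizable_closed (@apt_metrizable R Z)) => x_ x xA xx.
have cA' := cA; rewrite closed_coneE in cA'.
apply: (cA' (fun n => Ideal (ideal_pt (x_ n)))) => //.
apply: (shadow_cone_cvg qmZ) => u v; rewrite /= ideal_ptK.
have lim t : alpha t (endpoint (ideal_pt (x_ n))) @[n --> \oo] --> alpha t x.
  under eq_fun do rewrite ideal_ptK alpha_sym.
  rewrite (alpha_sym t).
  by apply: (@cvg_comp _ _ _ x_ (alpha^~ t) _ _ _ xx); exact: alpha_continuous.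
have := cvgB (cvgM (lim u) (cvg_cst (alpha v x)))
  (cvgM (lim v) (cvg_cst (alpha u x))).
by rewrite (mulrC (alpha v x)) subrr; apply.
Qed.

Let pull x : boundary Y := k (ideal_pt x).

Let pull_continuous : continuous pull.
Proof.
move=> x; apply: (@continuous_comp _ _ _ ideal_pt k);
  [exact: ideal_pt_continuous|exact: k_continuous].
Qed.

Let pullK b : pull (endpoint (g b)) = b.
Proof. by rewrite /pull endpointK gK. Qed.

Let pull_inj : injective pull.
Proof.
move=> x x' /(congr1 g); rewrite /pull !kK => /(congr1 endpoint).
by rewrite !ideal_ptK.
Qed.

Let ex (u : \bar R) : R := fine (expeR (- u)%E).

Let ex_ge0 u : 0 <= ex u.
Proof. by rewrite /ex fine_ge0// expeR_ge0. Qed.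

Let ex_eq0 u : (0 <= u)%E -> ex u = 0 -> u = +oo%E.
Proof.
by case: u => [r| |]//= _ /eqP; rewrite /ex /= expR_eq0.
Qed.

Let ex_le1 u : (0 <= u)%E -> ex u <= 1.
Proof.
case: u => [r| |]//= r0; rewrite /ex /= ?ler01//.
by rewrite expR_le1 oppr_le0 -lee_fin.
Qed.

Let exD u (r : R) : (0 <= u)%E -> ex (u + r%:E)%E = ex u * expR (- r).
Proof.
case: u => [s| |]//= s0; rewrite /ex /= ?mul0r//.
by rewrite opprD expRD.
Qed.

Let f_ge0 y zw : (0 <= f y zw)%E.
Proof. by have [_ + _] := fP y; apply. Qed.

Let pulled y x x' : R := ex (f y (Ideal (pull x), Ideal (pull x'))).

Let pulled_antipodal y : antipodal (pulled y).
Proof.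
apply: antipodal_of_le1; first split.
- move=> p; apply: (@continuous_comp _ _ _
    (fun p : Z * Z => f y (Ideal (pull p.1), Ideal (pull p.2))) ex);
    last by apply: fine_expeRN_continuous; exact: f_ge0.
  apply: (@continuous_comp _ _ _
    (fun p : Z * Z => (Ideal (pull p.1), Ideal (pull p.2))) (f y));
    last by have [c _ _] := fP y; exact: c.
  have cI : continuous (fun x => Ideal (pull x)).
    move=> x; apply: (@continuous_comp _ _ _ pull (@Ideal R Y));
      [exact: pull_continuous|exact: Ideal_continuous].
  apply: (@cvg_pair _ _ _ (nbhs p) (nbhs (Ideal (pull p.1)))
    (nbhs (Ideal (pull p.2)))).
    by apply: (@continuous_comp _ _ _ fst (fun x => Ideal (pull x)));
      [exact: cvg_fst|exact: cI].
  by apply: (@continuous_comp _ _ _ snd (fun x => Ideal (pull x)));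
    [exact: cvg_snd|exact: cI].
- by move=> x x'; exact: ex_ge0.
- by move=> x x'; rewrite /pulled (ext_ideal_sym properY geoY hypY (fP y)).
- move=> x x'; split=> [/(ex_eq0 (f_ge0 _ _))|->].
    by move/(ext_ideal_infty properY geoY hypY (fP y))/pull_inj.
  by rewrite /pulled (ext_idealxx properY geoY hypY (fP y)).
- by move=> x x'; exact: ex_le1.
- move=> x.
  have [eta E] := exists_opposite properY geoY hypY completeY (pull x) (fP y).
  exists (endpoint (g eta)); rewrite /pulled pullK E.
  by rewrite /ex /= oppr0 expR0.
Qed.

Let pulled_equivalent y : moebius_equivalent alpha (pulled y).
Proof.
move=> x x' v v' u.
have u' : uniq [:: pull x; pull x'; pull v; pull v'].
  by rewrite -[X in uniq X]/(map pull [:: x; x'; v; v']) map_inj_uniq.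
have := moebius_g y o u'; rewrite /pull !kK /cross_ratio.
by rewrite !(visual_fun_moebius qmZ) !ideal_ptK.
Qed.

Let G y : M := MoebiusSpace (pulled_antipodal y) (pulled_equivalent y).

Let bus y y' x : R := busemann (f y) y y' (pull x).

Let mcoord_G y y' x : mcoord (G y') x = mcoord (G y) x + bus y y' x / 2.
Proof.
have sep : separating (G y) by have [] := ms_antipodal (G y).
have E := @derivativeE _ _ (apt_four Z) (G y) (G y') (fun x => expR (- bus y y' x)) sep.
have := derivative_mcoord (G y) (G y') x; rewrite E.
  by move/expR_inj; lra.
split=> [v|v|v w]; [|exact: expR_gt0|].
  apply: (@continuous_comp _ _ _ (fun x => - bus y y' x) (@expR R));
    last exact: continuous_expR.
  apply: cvgN; apply: cvgB; first exact: cvg_cst.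
  apply: cvgM; first exact: cvg_cst.
  apply: fine_cvg; rewrite -(ext_inner_fin properY geoY hypY (fP y)).
  apply: (@continuous_comp _ _ _ (fun x => (Inner y', Ideal (pull x))) (f y));
    last by have [c _ _] := fP y; exact: c.
  apply: (@cvg_pair _ _ _ (nbhs v) (nbhs (Inner y')) (nbhs (Ideal (pull v))));
    first exact: cvg_cst.
  by apply: (@continuous_comp _ _ _ pull (@Ideal R Y));
    [exact: pull_continuous|exact: Ideal_continuous].
rewrite /= /pulled.
rewrite (ext_change_base properY geoY hypY (pull v) (pull w) (fP y) (fP y')).
rewrite exD ?f_ge0// exprMn mulrC; congr (_ * _).
by rewrite expr2 -!expRD; congr expR; rewrite /bus; field.
Qed.

Let G_isometry y y' : mdist (G y) (G y') = mdist y y'.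
Proof.
have E x : `|mcoord (G y) x - mcoord (G y') x| = `|bus y y' x| / 2.
  rewrite (mcoord_G y y') opprD addrA subrr sub0r normrN normrM.
  by rewrite (ger0_norm (_ : 0 <= 2^-1)).
apply/eqP; rewrite eq_le; apply/andP; split.
  have [x ->] := mdist_mcoord_attained (G y) (G y'); rewrite E.
  have := busemann_le properY geoY hypY y' (pull x) (fP y).
  by rewrite -/(bus y y' x); lra.
have [xi xiE] := busemann_attained properY geoY hypY completeY y' (fP y).
have := mdist_mcoord_ge (G y) (G y') (endpoint (g xi)).
rewrite E /bus pullK xiE normrN ger0_norm ?mdist_ge0//; lra.
Qed.

(* The factor m depends on z only and is bounded, which is what the projective
   criterion [shadow_cone_cvg] can absorb. *)
Let shadow_G y z : exists m : R, 0 <= m <= expR (mradius (G y)) /\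
  forall x, shadow (compactification_map G g z) x =
    m * (expR (mcoord (G y) x) * ex (f y (z, Ideal (pull x)))).
Proof.
case: z => [y'|b].
  exists (expR (mdist y y' / 2 - mradius (G y'))); split.
    rewrite expR_ge0 ler_expR /=.
    have := metric_triangle (G y) o (G y'); rewrite G_isometry.
    rewrite (metric_sym (G y)) /mradius.
    by move: (mdist o (G y)) (mdist o (G y')) (mdist y y') => *; lra.
  move=> x; rewrite /= (ext_inner_fin properY geoY hypY (fP y)) /ex /= -!expRD.
  by rewrite (mcoord_G y y') /bus /busemann; congr expR; field.
exists (expR (mcoord (G y) (endpoint (g b)))); split.
  by rewrite expR_ge0 ler_expR; have [] := mcoord_mradius (G y) (endpoint (g b)).
move=> x /=; have E : G y x (endpoint (g b)) = ex (f y (Ideal b, Ideal (pull x))).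
  by rewrite /= /pulled pullK (ext_ideal_sym properY geoY hypY (fP y)).
rewrite -E mcoordE.
move: (alpha x _) (mcoord (G y) x) (mcoord (G y) _) => a u v.
rewrite (_ : _ * _ = a * (expR v * (expR u * expR (- u - v)))); last by ring.
by rewrite -!expRD (_ : v + _ = 0) ?expR0 ?mulr1//; ring.
Qed.

Let G_continuous : continuous (compactification_map G g).
Proof.
apply: cone_continuous => z_ z zc; exists id.
have [y _] : exists y : Y, True.
  by case: (z) => [y|b]; [exists y|have [c _ _] := bd_exists b; exists (c 0)].
apply: cone_cvg_topology; apply: (shadow_cone_cvg qmZ) => u v.
have lim x : ex (f y (z_ n, Ideal (pull x))) @[n --> \oo] -->
    ex (f y (z, Ideal (pull x))).
  have := fine_expeRN_continuous (f_ge0 y (z, Ideal (pull x))).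
  apply: (@cvg_comp _ _ _ (fun n => f y (z_ n, Ideal (pull x))) ex).
  have [c _ _] := fP y.
  apply: (@cvg_comp _ _ _ (fun n => (z_ n, Ideal (pull x))) (f y) _ _ _ _
    (c (z, Ideal (pull x)))).
  by apply: (@cvg_pair _ _ _ \oo (nbhs z) (nbhs (Ideal (pull x))));
    [exact: cone_cvg_topology|exact: cvg_cst].
have [m_ mP] := choice (fun n => shadow_G y (z_ n)).
have [m [m0 mE]] := shadow_G y z.
pose C := m * (expR (mcoord (G y) u) * expR (mcoord (G y) v)).
pose d n := ex (f y (z_ n, Ideal (pull u))) * ex (f y (z, Ideal (pull v))) -
  ex (f y (z_ n, Ideal (pull v))) * ex (f y (z, Ideal (pull u))).
have d0 : d @ \oo --> (0 : R).
  have := cvgB (cvgM (lim u) (cvg_cst (ex (f y (z, Ideal (pull v))))))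
    (cvgM (lim v) (cvg_cst (ex (f y (z, Ideal (pull u)))))).
  by rewrite (mulrC (ex (f y (z, Ideal (pull v))))) subrr; apply.
have E n : shadow (compactification_map G g (z_ n)) u *
      shadow (compactification_map G g z) v -
    shadow (compactification_map G g (z_ n)) v *
      shadow (compactification_map G g z) u = m_ n * (C * d n).
  by have [_ h] := mP n; rewrite !h !mE /C /d; ring.
under eq_fun do rewrite E.
have C0 : 0 <= C by rewrite /C !mulr_ge0 ?expR_ge0//; have /andP[] := m0.
have : (fun n => expR (mradius (G y)) * (C * `|d n|)) @ \oo --> (0 : R).
  have := cvgM (cvg_cst (expR (mradius (G y)))) (cvgM (cvg_cst C) (cvg_norm d0)).
  by rewrite normr0 !mulr0; apply.
move=> h; apply/norm_cvg0P; apply: (squeeze_cvgr _ (cvg_cst 0) h).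
apply: nearW => n; rewrite normr_ge0/= normrM (normrM C) (ger0_norm C0).
have [/andP[h1 h2] _] := mP n; rewrite (ger0_norm h1).
by apply: ler_wpM2r => //; rewrite mulr_ge0.
Qed.

Lemma moebius_extension : exists G : Y -> M,
  (forall y y', mdist (G y) (G y') = mdist y y') /\
  continuous (compactification_map G g).
Proof. by exists G; split; [exact: G_isometry|exact: G_continuous]. Qed.

End maximality.

Theorem theorem1p3 (R : realType) (Z : antipodalSpace R) :
  quasi_metric Z -> maximal_gromov_hyperbolic (moebius_space Z).
Proof.
move=> qmZ; split; first exact: moebius_good.
move=> Y goodY g [gc [k [kc gK kK]]] gm.
exact: (moebius_extension qmZ goodY kc gK kK gm).
Qed.
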